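(* Fix $T>0$. For every $\Gamma$-invariant local function bundle for vertices $f:V\times Z\to\mathbb{R}$, every sequence of initial probability measures $\mu_m$ on $Z_m$ (with $\mathbb{P}_m$ the law on $D([0,T],Z_m)$ of the continuous time Markov chain $\eta(t)=\eta_m(t)$ generated by $t_mL_m$ with initial measure $\mu_m$) and every $\delta>0$, $$ \lim_{i\to\infty}\limsup_{\varepsilon\to 0}\limsup_{m\to\infty}\frac{1}{[\Gamma:\Gamma_m]}\log\mathbb{P}_m\left(\frac{1}{[\Gamma:\Gamma_m]}\int_0^T V_{o,m,\varepsilon,i}(\eta(t))\,dt\ge\delta\right)=-\infty, $$ where, for $\eta\in Z_m$, $$ V_{o,m,\varepsilon,i}(\eta)=\sum_{\underline\sigma\in\Gamma/\Gamma_m}\left|\overline f_{\underline\sigma o,i}(\eta)-\langle f_o\rangle\left(\overline\eta_{\underline\sigma o,\,b(\varepsilon\sqrt{t_m})}\right)\right|. $$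
   Context: **Group and graphs.** $\Gamma$ is an infinite group generated by a finite symmetric set $S=S^{-1}$, with word norm $|\cdot|_\Gamma$. $\Gamma$ is residually finite: fix a descending sequence of finite index normal subgroups $\{\Gamma_i\}_{i\ge 0}$ of $\Gamma$ with $\bigcap_{i\ge1}\Gamma_i=\{id\}$. $\Gamma$ is amenable: fix a Følner sequence $\{F_i\}_{i\ge1}$, i.e. (nonempty) finite subsets of $\Gamma$ with $\lim_{i\to\infty}|\partial_SF_i|/|F_i|=0$, where $\partial_SF_i:=F_iS\setminus F_i$. $X=(V,E)$ is the Cayley graph: $V=\Gamma$, oriented edges $E=\{(x,xs): x\in\Gamma,\ s\in S\}$; each edge $e$ has origin $oe$, terminus $te$ and reversed edge $\overline e\in E$. $d$ is the graph distance and $B(x,r)$ the ball of radius $r$ about $x$ in $V$. $\Gamma$ acts on $X$ from the left, freely and vertex transitively. $X_m=(V_m,E_m):=\Gamma_m\backslash X$ is the finite quotient graph, with covering map $\pi_m:V\to V_m$; the finite group $\Gamma/\Gamma_m$ acts on it freely and vertex transitively, and $|V_m|=[\Gamma:\Gamma_m]$. Fix a vertex $o\in V$; its image in $V_m$ is also written $o$. For $\sigma\in\Gamma$, $\underline\sigma$ is its image in $\Gamma/\Gamma_m$. **Configurations and local function bundles.** $Z:=\{0,1\}^V$, $Z_m:=\{0,1\}^{V_m}$, with the product topology. $\Gamma$ acts on $Z$ by $(\sigma\eta)_z:=\eta_{\sigma^{-1}z}$, and $\Gamma/\Gamma_m$ acts on $Z_m$ similarly. A $\Gamma$-invariant local function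 bundle for vertices is a function $f:V\times Z\to\mathbb{R}$, $f_x(\eta)=f(x,\eta)$, such that (1) there is $r\ge0$ such that for every $x\in V$, $f_x$ depends only on $\{\eta_z\}_{z\in B(x,r)}$; (2) $f(\sigma x,\sigma\eta)=f(x,\eta)$ for all $\sigma\in\Gamma,x\in V,\eta\in Z$. A $\Gamma$-invariant local function bundle for edges is a function $f:E\times Z\to\mathbb{R}$ such that (1) there is $r\ge0$ such that for every $e\in E$, $f_e$ depends only on $\{\eta_z\}_{z\in B(oe,r)\cup B(te,r)}$; (2) $f(\sigma e,\sigma\eta)=f(e,\eta)$ for all $\sigma\in\Gamma,e\in E,\eta\in Z$. By invariance such bundles induce functions on $V_m\times Z_m$ and $E_m\times Z_m$, written with the same letter: the value at (the image of $x$ or $e$, $\eta\in Z_m$) is the value of $f$ at ($x$ or $e$, $\iota_m\eta$), where $(\iota_m\eta)_z:=\eta_{\pi_m(z)}$ is the periodic extension. **Local and global averages.** For $x=\gamma o$ with $\gamma\in\Gamma$, $\overline f_{x,i}:=\frac{1}{|F_i|}\sum_{\sigma\in F_i}f_{\gamma\sigma o}$. This is again a $\Gamma$-invariant local function bundle, and it induces $\overline f_{\underline\gamma o,i}:Z_m\to\mathbb{R}$. $\overline\eta_{x,i}$ denotes this local average for the bundle $f_x(\eta)=\eta_x$. For $K\ge0$, $b(K)$ is the largest $L$ such that $F_1,\dots,F_L\subseteq B(o,K)$ (as subsets of $V=\Gamma$); it is defined for all large $K$, is non-decreasing and tends to $\infty$. $\overline\eta_{x,b(K)}$ is the local average with $i=b(K)$.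 For $0\le\rho\le1$, $\nu_\rho$ is the $\rho$-Bernoulli product measure on $Z$ and $\langle f_o\rangle(\rho):=\mathbb{E}_{\nu_\rho}[f_o]$. **Exclusion process.** For an edge $e$, $\eta^e$ is $\eta$ with the values at $oe$ and $te$ exchanged, and $\pi_eF(\eta):=F(\eta^e)-F(\eta)$. A jump rate is fixed: a $\Gamma$-invariant local function bundle for edges $c:E\times Z\to\mathbb{R}$ with $c(e,\eta)=c(\overline e,\eta)$ and $c(e,\eta)=c(e,\eta^e)$ for all $e\in E,\eta\in Z$, and $c(e,\eta)\ge c_0$ for all $e,\eta$, for some constant $c_0>0$. $\nu_m$ is the $(1/2)$-Bernoulli product measure on $Z_m$, and $L_m$ is the operator on $L^2(Z_m,\nu_m)$ given by $L_mF(\eta):=\sum_{e\in E_m}c(e,\eta)\pi_eF(\eta)$. The time scaling factors satisfy $0<t_1<t_2<\cdots$, $t_m\to\infty$, and $\sqrt{t_m}\le 2\,\mathrm{diam}\,X_m$. $D([0,T],Z_m)$ is the space of right-continuous paths with left limits. *)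

(* Defs.v *)
From HB Require Import structures.
From mathcomp Require Import all_boot all_order all_algebra.
From mathcomp Require Import finmap.
From mathcomp Require Import all_classical all_reals all_analysis.

Set Implicit Arguments.
Unset Strict Implicit.
Unset Printing Implicit Defensive.

Import Order.TTheory GRing.Theory Num.Theory.
Import numFieldNormedType.Exports.

Local Open Scope classical_set_scope.
Local Open Scope ring_scope.

(* Graph distance for an adjacency relation.  The value 0 taken by [gdist] on
   disconnected pairs is never used: all graphs below are connected. *)

Fixpoint walk (V : Type) (adj : V -> V -> Prop) (n : nat) (x y : V) : Prop :=
  if n is k.+1 then exists2 z, adj x z & walk adj k z y else x = y.

Definition gdist (V : Type) (adj : V -> V -> Prop) (x y : V) : nat :=
  xget 0%N [set n | walk adj n x y /\
                    forall k, walk adj k x y -> (n <= k)%N].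

Section Group.
Variable Gam : groupType.

Definition is_subgroup (H : set Gam) : Prop :=
  [/\ H 1%g, forall x y, H x -> H y -> H (x * y)%g
           & forall x, H x -> H (x^-1)%g].

Definition is_normal (H : set Gam) : Prop :=
  forall g h, H h -> H (g * h * g^-1)%g.

Definition generated_by (S : {fset Gam}) : Prop :=
  forall H : set Gam, is_subgroup H -> [set` S] `<=` H -> H = setT.

Definition symmetric_set (S : {fset Gam}) : Prop :=
  forall s, s \in S -> (s^-1)%g \in S.

Definition edges (S : {fset Gam}) : set (Gam * Gam) :=
  [set e | exists2 s, s \in S & e.2 = (e.1 * s)%g].

Definition cayley_adj (S : {fset Gam}) (x y : Gam) : Prop := edges S (x, y).

Definition cball (R : realType) (S : {fset Gam}) (x : Gam) (r : R) : set Gam :=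
  [set y | (gdist (cayley_adj S) x y)%:R <= r].

Definition outer_boundary (S F : {fset Gam}) : {fset Gam} :=
  ([fset (x * s)%g | x in F, s in S] `\` F)%fset.

Definition folner (R : realType) (S : {fset Gam}) (F : nat -> {fset Gam}) :
    Prop :=
  (forall i, (1 <= i)%N -> F i != fset0) /\
  (fun i => (#|` outer_boundary S (F i)|%:R / #|` F i|%:R : R)) @ \oo --> (0 : R).

(* Orbits of a subgroup acting from the left on vertices and on edges. *)
Definition orbit (N : set Gam) (x : Gam) : set Gam := [set (g * x)%g | g in N].

Definition edge_orbit (N : set Gam) (e : Gam * Gam) : set (Gam * Gam) :=
  [set ((g * e.1)%g, (g * e.2)%g) | g in N].

Record finite_index_normal := FiniteIndexNormal {
  fin_set :> set Gam ;
  fin_subgroup : is_subgroup fin_set ;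
  fin_isnormal : is_normal fin_set ;
  fin_finite : finite_set (range (orbit fin_set)) }.

(* The vertex set of N \ X, as a finite type of orbits.  As N is normal, the
   orbit N x is the coset x N, so this is also the underlying set of the
   quotient group Gam / N, and its cardinality is the index of N. *)
Definition quot (N : finite_index_normal) : finType :=
  fset_set (range (orbit N)).

Lemma orbit_quot (N : finite_index_normal) (x : Gam) :
  orbit N x \in fset_set (range (orbit N)).
Proof.
by rewrite in_fset_set ?inE; [exists x | exact: fin_finite].
Qed.

Definition proj (N : finite_index_normal) (x : Gam) : quot N :=
  FSetSub (orbit_quot N x).

Definition lift_quot (N : finite_index_normal) (q : quot N) : Gam :=
  xget 1%g (val q : set Gam).

Lemma finite_edge_orbits (S : {fset Gam}) (N : finite_index_normal) :
  finite_set (edge_orbit N @` edges S).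
Proof.
pose h (p : set Gam * Gam) : set (Gam * Gam) :=
  [set (y, (y * p.2)%g) | y in p.1].
have fin : finite_set (h @` (range (orbit N) `*` [set` S])).
  by apply: finite_image; apply: finite_setX; [exact: fin_finite|].
apply: sub_finite_set fin => _ [[x y] /= [s sS /= ->] <-].
exists (orbit N x, s); first by split => //=; exists x.
rewrite /h /edge_orbit /=; apply/seteqP; split => /= z.
  by move=> [_ [g Ng <-] <-]; exists g => //; rewrite mulgA.
by move=> [g Ng <-]; exists (g * x)%g; [exists g | rewrite mulgA].
Qed.

(* The edge set of N \ X: distinct edge orbits may join the same vertices. *)
Definition quot_edge (S : {fset Gam}) (N : finite_index_normal) : finType :=
  fset_set (edge_orbit N @` edges S).

Definition lift_edge (S : {fset Gam}) (N : finite_index_normal)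
    (e : quot_edge S N) : Gam * Gam :=
  xget (1%g, 1%g) (val e : set (Gam * Gam)).

Definition quot_origin S N (e : quot_edge S N) : quot N :=
  proj N (lift_edge e).1.
Definition quot_terminus S N (e : quot_edge S N) : quot N :=
  proj N (lift_edge e).2.

Definition quot_adj (S : {fset Gam}) (N : finite_index_normal) (u v : quot N) :
    Prop :=
  exists e : quot_edge S N, quot_origin e = u /\ quot_terminus e = v.

Definition quot_diam (S : {fset Gam}) (N : finite_index_normal) : nat :=
  \max_(u : quot N) \max_(v : quot N) gdist (quot_adj S (N := N)) u v.

(* Configurations. *)

Definition config := Gam -> bool.
Definition qconfig (N : finite_index_normal) := {ffun quot N -> bool}.

Definition cact (g : Gam) (eta : config) : config := fun z => eta (g^-1 * z)%g.

Definition swap (V : eqType) (x y : V) (eta : V -> bool) : V -> bool :=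
  fun z => if z == x then eta y else if z == y then eta x else eta z.

Definition qswap (N : finite_index_normal) (x y : quot N) (eta : qconfig N) :
  qconfig N := [ffun z => swap x y eta z].

Definition periodic (N : finite_index_normal) (eta : qconfig N) : config :=
  fun z => eta (proj N z).

Section Real.
Variable R : realType.

Definition vertex_bundle (S : {fset Gam}) (f : Gam -> config -> R) : Prop :=
  (exists2 r : R, 0 <= r & forall x (eta xi : config),
     (forall z, cball S x r z -> eta z = xi z) -> f x eta = f x xi) /\
  (forall g x eta, f (g * x)%g (cact g eta) = f x eta).

(* Only the values of c on [edges S] are relevant. *)
Definition edge_bundle (S : {fset Gam}) (c : Gam * Gam -> config -> R) : Prop :=
  (exists2 r : R, 0 <= r & forall e, edges S e -> forall eta xi : config,
     (forall z, (cball S e.1 r `|` cball S e.2 r) z -> eta z = xi z) ->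
     c e eta = c e xi) /\
  (forall g e eta, edges S e ->
     c ((g * e.1)%g, (g * e.2)%g) (cact g eta) = c e eta).

Definition jump_rate (S : {fset Gam}) (c : Gam * Gam -> config -> R) : Prop :=
  [/\ edge_bundle S c,
      forall e eta, edges S e -> c e eta = c (e.2, e.1) eta,
      forall e eta, edges S e -> c e eta = c e (swap e.1 e.2 eta) &
      exists2 c0 : R, 0 < c0 & forall e eta, edges S e -> c0 <= c e eta].

(* Average over the vertices g s o, s in F, where x = g o. *)
Definition local_avg (o : Gam) (F : {fset Gam}) (f : Gam -> config -> R)
    (x : Gam) (eta : config) : R :=
  #|` F|%:R^-1 * \sum_(s <- F) f (x * o^-1 * s * o)%g eta.

Definition occupation (x : Gam) (eta : config) : R := (eta x)%:R.

Definition largest_inside (S : {fset Gam}) (o : Gam) (F : nat -> {fset Gam})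
    (K : R) : nat :=
  let inside L := forall i, (1 <= i <= L)%N -> [set` F i] `<=` cball S o K in
  xget 0%N [set L | inside L /\ forall L', inside L' -> (L' <= L)%N].

Definition exclusion_gen (S : {fset Gam}) (c : Gam * Gam -> config -> R)
    (N : finite_index_normal) (F : qconfig N -> R) (eta : qconfig N) : R :=
  \sum_(e : quot_edge S N) c (lift_edge e) (periodic eta) *
    (F (qswap (quot_origin e) (quot_terminus e) eta) - F eta).

End Real.
End Group.

(* Product and path spaces carry the sigma-algebra generated by their
   coordinate maps. *)
Definition coord_sets (I T U : Type) (X : I -> T -> U) : set (set T) :=
  [set A | exists i u, A = [set t | X i t = u]].

HB.instance Definition _ (T : finType) (U : pointedType) :=
  isPointed.Build {ffun T -> U} [ffun=> point].

Definition configSpace (Gam : groupType) :=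
  g_sigma_algebraType (coord_sets (fun (x : Gam) (eta : Gam -> bool) => eta x)).

HB.instance Definition _ (Gam : groupType) (N : finite_index_normal Gam) :=
  Pointed.on (qconfig N).

Definition qconfigSpace (Gam : groupType) (N : finite_index_normal Gam) :=
  g_sigma_algebraType
    (coord_sets (fun (x : quot N) (eta : qconfig N) => eta x)).

(* Cadlag paths [0, T] -> X for a finite discrete X; in a discrete space
   one-sided convergence is one-sided eventual constancy.  A path is encoded as
   a function on the whole line, frozen outside of [0, T], so that it carries
   no information besides its restriction to [0, T]. *)
Record cadlag (R : realType) (T : R) (X : Type) := Cadlag {
  cadlag_fun :> R -> X ;
  cadlag_right : forall s, 0 <= s < T ->
    \forall u \near s^'+, cadlag_fun u = cadlag_fun s ;
  cadlag_left : forall s, 0 < s <= T ->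
    exists x, \forall u \near s^'-, cadlag_fun u = x ;
  cadlag_frozen : forall s,
    cadlag_fun s = cadlag_fun (Num.max 0 (Num.min s T)) }.

Section Cadlag.
Variables (R : realType) (T : R) (X : pointedType).

Let cst_cadlag : cadlag T X.
Proof.
apply: (@Cadlag _ _ _ (fun=> point)) => // s _.
- exact: nearW.
- by exists point; exact: nearW.
Qed.

HB.instance Definition _ := gen_eqMixin (cadlag T X).
HB.instance Definition _ := gen_choiceMixin (cadlag T X).
HB.instance Definition _ := isPointed.Build (cadlag T X) cst_cadlag.

Definition pathSpace :=
  g_sigma_algebraType (coord_sets (fun (s : R) (w : cadlag T X) => w s)).

End Cadlag.

Section Probability.
Variable R : realType.

Definition bernoulli_product (Gam : groupType) (rho : R)
    (nu : probability (configSpace Gam) R) : Prop :=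
  forall (A : {fset Gam}) (a : Gam -> bool),
    nu [set eta | forall x, x \in A -> eta x = a x] =
    (\prod_(x <- A) (if a x then rho else 1 - rho))%:E.

(* exp(s L), as a power series. *)
Definition semigroup (X : Type) (L : (X -> R) -> (X -> R)) (s : R)
    (F : X -> R) (x : X) : R :=
  limn (series (fun k => s ^+ k / k`!%:R * iter k L F x)).

Definition transition (X : eqType) (L : (X -> R) -> (X -> R)) (s : R)
    (x y : X) : R :=
  semigroup L s (fun z => (z == y)%:R) x.

Fixpoint transitions (X : eqType) (L : (X -> R) -> (X -> R)) (s : R) (x : X)
    (l : seq (R * X)) : R :=
  if l is (u, y) :: l' then transition L (u - s) x y * transitions L u y l'
  else 1.

(* P is the law on D([0, T], X) of the Markov chain generated by L with
   initial law mu, characterized by its finite-dimensional distributions. *)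
Definition markov_law (T : R) (X : pointedType) (L : (X -> R) -> (X -> R))
    (mu : set X -> \bar R) (P : probability (pathSpace T X) R) : Prop :=
  forall (x : X) (l : seq (R * X)),
    path <=%R 0 (map fst l) -> all (<= T) (map fst l) ->
    P [set w : cadlag T X | w 0 = x /\ forall p, p \in l -> w p.1 = p.2] =
    (mu [set x] * (transitions L 0 x l)%:E)%E.

(* <f_o>(rho), with nu rho the rho-Bernoulli product measure. *)
Definition bernoulli_mean (Gam : groupType)
    (nu : R -> probability (configSpace Gam) R) (f : Gam -> config Gam -> R)
    (o : Gam) (rho : R) : R :=
  fine 'E_(nu rho)[f o].

(* V_{o,m,eps,i}, with K = eps * sqrt t_m; the group Gam / N is enumerated by
   its cosets, and the vertex sigma o is lifted to Gam. *)
Definition replacement_error (Gam : groupType) (S : {fset Gam})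
    (F : nat -> {fset Gam}) (nu : R -> probability (configSpace Gam) R)
    (f : Gam -> config Gam -> R) (o : Gam) (N : finite_index_normal Gam)
    (K : R) (i : nat) (eta : qconfig N) : R :=
  \sum_(q : quot N)
    `| local_avg o (F i) f (lift_quot q * o)%g (periodic eta) -
       bernoulli_mean nu f o
         (local_avg o (F (largest_inside S o F K)) (@occupation Gam R)
            (lift_quot q * o)%g (periodic eta)) |.

End Probability.

(* Main.v *)
Require Import Defs.
From HB Require Import structures.
From mathcomp Require Import all_boot all_order all_algebra.
From mathcomp Require Import finmap.
From mathcomp Require Import all_classical all_reals all_analysis.
From mathcomp Require Import measurable_realfun ring lra.

Set Implicit Arguments.
Unset Strict Implicit.
Unset Printing Implicit Defensive.

Import Order.TTheory GRing.Theory Num.Theory.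
Import numFieldNormedType.Exports.

Local Open Scope classical_set_scope.
Local Open Scope ring_scope.

(** Exponential moments turn the estimate into a quadratic form bound.  Let
    [n] be the number of vertices of the quotient and [V] the replacement
    error, a function on configurations.  By the Feynman-Kac argument
    ([feynman_kac]), if [<g, (t L + a V) g> <= n |g|^2] for all [g], then the
    probability that the time integral of [V] exceeds [n delta] is at most
    [exp (n (2 + T - a delta / 2))].  As [a] is arbitrary, this gives any rate
    of decay, provided that the bound holds for every [a] once [i] is large,
    [eps] is small and [m] is large ([quadratic_form_bound]).  The initial law
    only costs the factor [2 ^ n], the number of configurations.

    For the quadratic form, the large block itself is used to randomise the
    small window on which the average of [f] over [F i] depends.  Exchange each
    site of the window with an independent uniform site of the block of index
    [b (eps sqrt t)].  Unless two of the sites involved collide, the values seen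
    in the window are then independent Bernoulli variables whose parameter is
    the density of the block ([replacement]).  Three errors have to be small:
    - the remaining Bernoulli expectation of the deviation of the average of
      [f] from its mean is small for large [i] by an Efron-Stein bound
      ([bern_exp_variance], [window_avg_deviation]);
    - collisions are rare, because a Foelner set meets each coset of a deep
      subgroup in a small proportion ([coset_fraction]);
    - against the density [g ^+ 2], exchanging two sites costs the square root
      of the energy of the exchange ([exchange_cost]).  The sites are at
      distance at most [2 eps sqrt t], so a path of nearest neighbour exchanges
      and translation invariance bound the total energy by a multiple of
      [eps ^+ 2 * t] times the Dirichlet form of [L] ([path_energy],
      [dirichlet_form]).  For small [eps] this is absorbed by the negative term
      [t <g, L g>].

    The quotient generator is reversible only for large [m], when the lifts of
    an edge are far apart compared with the range of the rate
    ([rate_exchange]).  In the Feynman-Kac argument the semigroup is expanded to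
    first order over short time steps ([tilted_norm]), and the Riemann sums so
    obtained converge to the time integral by right-continuity of the paths
    ([riemann_sum_cvg]). *)

(** * Expectation under independent Bernoulli trials *)

Section BernoulliExpectation.
Variable R : realType.
Implicit Types (p : R) (phi psi : seq bool -> R).

Fixpoint bern_exp p (n : nat) phi : R :=
  if n is k.+1 then
    p * bern_exp p k (fun s => phi (true :: s)) +
    (1 - p) * bern_exp p k (fun s => phi (false :: s))
  else phi [::].

Lemma eq_bern_exp p n phi psi : phi =1 psi ->
  bern_exp p n phi = bern_exp p n psi.
Proof. by move=> /funext ->. Qed.

Lemma bern_exp_cst p n a : bern_exp p n (fun=> a) = a.
Proof. by elim: n => //= n ->; ring. Qed.

Lemma bern_expD p n phi psi :
  bern_exp p n (fun s => phi s + psi s) = bern_exp p n phi + bern_exp p n psi.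
Proof. by elim: n phi psi => //= n IH phi psi; rewrite !IH; ring. Qed.

Lemma bern_expZ p n a phi :
  bern_exp p n (fun s => a * phi s) = a * bern_exp p n phi.
Proof. by elim: n phi => //= n IH phi; rewrite !IH; ring. Qed.

Lemma bern_exp_sum p n (I : Type) (r : seq I) (phi : I -> seq bool -> R) :
  bern_exp p n (fun s => \sum_(i <- r) phi i s) =
  \sum_(i <- r) bern_exp p n (phi i).
Proof.
elim: r => [|i r IH].
  rewrite big_nil -[RHS](bern_exp_cst p n).
  by apply: eq_bern_exp => s; rewrite big_nil.
rewrite big_cons -IH -bern_expD.
by apply: eq_bern_exp => s; rewrite big_cons.
Qed.

Lemma bern_exp_le p n phi psi : 0 <= p <= 1 -> (forall s, phi s <= psi s) ->
  bern_exp p n phi <= bern_exp p n psi.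
Proof.
move=> /andP[p0 p1]; elim: n phi psi => //= n IH phi psi le.
by apply: lerD; apply: ler_wpM2l; rewrite ?subr_ge0 //; apply: IH => s.
Qed.

Lemma bern_exp_norm p n phi C : 0 <= p <= 1 -> (forall s, `|phi s| <= C) ->
  `|bern_exp p n phi| <= C.
Proof.
move=> p01 le; rewrite ler_norml; apply/andP; split.
  rewrite -[leLHS](bern_exp_cst p n); apply: bern_exp_le => // s.
  by have := le s; rewrite ler_norml => /andP[].
rewrite -[leRHS](bern_exp_cst p n); apply: bern_exp_le => // s.
by have := le s; rewrite ler_norml => /andP[].
Qed.

Lemma bern_exp_lipschitz p p' n phi C : 0 <= p <= 1 -> 0 <= p' <= 1 ->
  (forall s, `|phi s| <= C) ->
  `|bern_exp p n phi - bern_exp p' n phi| <= 2 * C * n%:R * `|p - p'|.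
Proof.
move=> p01 p01'; elim: n phi => [|n IH] phi le /=.
  by rewrite subrr normr0 mulr0 mul0r.
set A := bern_exp p n _; set B := bern_exp p n _.
set A' := bern_exp p' n _; set B' := bern_exp p' n _.
have leA : `|A - A'| <= 2 * C * n%:R * `|p - p'| by apply: IH.
have leB : `|B - B'| <= 2 * C * n%:R * `|p - p'| by apply: IH.
have nA : `|A'| <= C by apply: bern_exp_norm.
have nB : `|B'| <= C by apply: bern_exp_norm.
have -> : p * A + (1 - p) * B - (p' * A' + (1 - p') * B') =
  (p * (A - A') + (1 - p) * (B - B')) + (p - p') * (A' - B') by ring.
apply: le_trans (ler_normD _ _) _; rewrite normrM.
have h1 : `|p * (A - A') + (1 - p) * (B - B')| <= 2 * C * n%:R * `|p - p'|.
  move: p01 => /andP[p0 p1].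
  apply: le_trans (ler_normD _ _) _; rewrite !normrM (ger0_norm p0).
  rewrite (@ger0_norm _ (1 - p)) ?subr_ge0 //.
  have := ler_wpM2l p0 leA; have : 0 <= 1 - p by rewrite subr_ge0.
  by move=> /ler_wpM2l/(_ _ _ leB); lra.
have h2 : `|p - p'| * `|A' - B'| <= `|p - p'| * (2 * C).
  apply: ler_wpM2l => //; apply: le_trans (ler_normB _ _) _; lra.
rewrite -natr1; lra.
Qed.

Lemma bern_exp_jensen p n phi : 0 <= p <= 1 ->
  (bern_exp p n phi) ^+ 2 <= bern_exp p n (fun s => phi s ^+ 2).
Proof.
move=> p01; set m := bern_exp p n phi.
have : 0 <= bern_exp p n (fun s => phi s ^+ 2 + (- 2 * m * phi s + m ^+ 2)).
  rewrite -(bern_exp_cst p n 0); apply: bern_exp_le => // s.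
  have -> : phi s ^+ 2 + (- 2 * m * phi s + m ^+ 2) = (phi s - m) ^+ 2 by ring.
  exact: sqr_ge0.
rewrite bern_expD (bern_expD p n (fun s => - 2 * m * phi s)) bern_expZ.
by rewrite bern_exp_cst -/m; nra.
Qed.

(** The Efron-Stein inequality: the variance splits along the first trial into
    the mean conditional variance and the variance of the conditional mean,
    and the two conditional means differ by at most the influence [c] of that
    trial. *)
Lemma bern_exp_variance p n phi c : 0 <= p <= 1 ->
  (forall s1 b b' s2, `|phi (s1 ++ b :: s2) - phi (s1 ++ b' :: s2)| <= c) ->
  bern_exp p n (fun s => phi s ^+ 2) - (bern_exp p n phi) ^+ 2 <=
  n%:R * c ^+ 2.
Proof.
move=> p01; elim: n phi => [|n IH] phi infl /=; first by rewrite subrr mul0r.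
have := IH (fun s => phi (true :: s)) (fun s1 => infl (true :: s1)).
have := IH (fun s => phi (false :: s)) (fun s1 => infl (false :: s1)).
set A2 := bern_exp p n (fun s => phi (false :: s) ^+ 2).
set B2 := bern_exp p n (fun s => phi (true :: s) ^+ 2).
set A := bern_exp p n (fun s => phi (false :: s)).
set B := bern_exp p n (fun s => phi (true :: s)) => hA hB.
have hAB : (B - A) ^+ 2 <= bern_exp p n (fun=> c ^+ 2).
  have -> : B - A = bern_exp p n (fun s => phi (true :: s) + -1 * phi (false :: s)).
    by rewrite bern_expD bern_expZ mulN1r.
  apply: le_trans (bern_exp_jensen _ _ p01) _.
  apply: bern_exp_le => // s; rewrite mulN1r -real_normK ?num_real //.
  have := infl [::] true false s => /= le.
  by rewrite ler_sqr ?nnegrE //; apply: le_trans le.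
rewrite bern_exp_cst in hAB.
move: p01 => /andP[p0 p1]; rewrite -natr1.
have hp : 0 <= p * (1 - p) by rewrite mulr_ge0 // subr_ge0.
have hp1 : p * (1 - p) <= 1 by nra.
have := ler_wpM2l hp hAB.
have c0 : 0 <= c ^+ 2 by exact: sqr_ge0.
have := ler_wpM2r c0 hp1.
have := ler_wpM2l p0 hB.
have q0 : 0 <= 1 - p by rewrite subr_ge0.
have := ler_wpM2l q0 hA.
move: (n%:R) => N; nra.
Qed.

(** Since |x| <= beta + x^2 / beta, the variance bound controls the mean
    deviation. *)
Lemma bern_exp_deviation p n phi c beta : 0 <= p <= 1 -> 0 < beta ->
  (forall s1 b b' s2, `|phi (s1 ++ b :: s2) - phi (s1 ++ b' :: s2)| <= c) ->
  bern_exp p n (fun s => `|phi s - bern_exp p n phi|) <=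
  beta + n%:R * c ^+ 2 / beta.
Proof.
move=> p01 b0 infl; set m := bern_exp p n phi.
have bV0 : 0 < beta^-1 by rewrite invr_gt0.
have : bern_exp p n (fun s => `|phi s - m|) <=
    bern_exp p n (fun s => beta + (beta^-1 * (phi s ^+ 2 + - 2 * m * phi s + m ^+ 2))).
  apply: bern_exp_le => // s.
  have -> : phi s ^+ 2 + - 2 * m * phi s + m ^+ 2 = `|phi s - m| ^+ 2.
    by rewrite real_normK ?num_real //; ring.
  have bb : beta * beta^-1 = 1 by rewrite divff // gt_eqF.
  move: (normr_ge0 (phi s - m)); set y := `|_|.
  move: (beta^-1) bV0 bb => b' b'0 bb y0.
  have by0 : 0 <= b' * y by rewrite mulr_ge0 // ltW.
  case: (lerP y beta) => h.
    by have := mulr_ge0 by0 y0; rewrite -mulrA -expr2 => ?; lra.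
  have hy : 0 <= b' * y * (y - beta) by rewrite mulr_ge0 // subr_ge0 ltW.
  have E : b' * y * (y - beta) = b' * y ^+ 2 - beta * b' * y by ring.
  by rewrite E bb mul1r in hy; lra.
move=> /le_trans; apply.
rewrite bern_expD bern_exp_cst bern_expZ !bern_expD bern_exp_cst bern_expZ -/m.
rewrite lerD2l mulrC ler_pM2r //.
by have := bern_exp_variance n p01 infl; rewrite -/m; nra.
Qed.

End BernoulliExpectation.

(** * Local functions under the Bernoulli product measure *)

Section BernoulliProduct.
Variables (R : realType) (Gam : groupType) (rho : R).
Variable nu : probability (configSpace Gam) R.
Hypothesis nu_bernoulli : bernoulli_product rho nu.
Local Notation Config := (configSpace Gam).

Lemma measurable_site (x : Gam) (b : bool) : measurable [set eta : Config | eta x = b].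
Proof. by apply: sub_sigma_algebra; exists x, b. Qed.

Lemma measurable_local (zs : seq Gam) (phi : seq bool -> R) :
  measurable_fun setT (fun eta : Config => phi (map eta zs)).
Proof.
elim: zs phi => [|z zs IH] phi /=; first exact: measurable_cst.
have -> : (fun eta : Config => phi (eta z :: map eta zs)) =
  (\1_[set eta : Config | eta z = true] \* (fun eta : Config => phi (true :: map eta zs))) \+
  (\1_[set eta : Config | eta z = false] \* (fun eta : Config => phi (false :: map eta zs))).
  have ind (eta : Config) b :
      \1_[set eta : Config | eta z = b] eta = (eta z == b)%:R :> R.
    by rewrite indicE; case: eqP => h; [rewrite mem_set|rewrite memNset].
  by apply/funext => eta; rewrite /= !ind; case: (eta z); rewrite /= ?mul1r ?mul0r ?addr0 ?add0r.
apply: measurable_funD; apply: measurable_funM.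
- by apply: measurable_indic; exact: measurable_site.
- exact: (IH (fun s => phi (true :: s))).
- by apply: measurable_indic; exact: measurable_site.
- exact: (IH (fun s => phi (false :: s))).
Qed.

Let agree (A : {fset Gam}) (a : Gam -> bool) : set Config :=
  [set eta | forall x, x \in A -> eta x = a x].

Let extend (a : Gam -> bool) z b x : bool := if x == z then b else a x.

Let agree_extend A a z b : z \notin A ->
  agree (z |` A)%fset (extend a z b) = agree A a `&` [set eta | eta z = b].
Proof.
move=> zA; apply/seteqP; split => eta; rewrite /agree /extend /=.
  move=> ea; split.
    move=> x xA; rewrite ea ?inE ?xA ?orbT //; case: eqP => // xz.
    by rewrite xz (negPf zA) in xA.
  by rewrite ea ?inE ?eqxx.
by case=> ea ez x; rewrite !inE => /orP[/eqP->|xA]; [rewrite eqxx|rewrite ea //; case: eqP => // xz; rewrite xz (negPf zA) in xA].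
Qed.

Let nu_extend A a z b : z \notin A ->
  nu (agree (z |` A)%fset (extend a z b)) =
  ((if b then rho else 1 - rho)%:E * nu (agree A a))%E.
Proof.
move=> zA; rewrite !nu_bernoulli big_fsetU1 //= -EFinM {1}/extend eqxx.
congr (_ * _)%:E; apply: eq_big_seq => x xA; rewrite /extend.
by case: eqP => // xz; rewrite xz (negPf zA) in xA.
Qed.

Let measurable_agree A a : measurable (agree A a).
Proof.
have -> : agree A a = \bigcap_(x in [set` A]) [set eta : Config | eta x = a x].
  by apply/seteqP; split => eta.
apply: fin_bigcap_measurable => // x _; exact: measurable_site.
Qed.

Let integral_agree (zs : seq Gam) (phi : seq bool -> R) A a : uniq zs ->
  (forall z, z \in zs -> z \notin A) ->
  (\int[nu]_(eta in agree A a) (phi (map eta zs))%:E =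
   (bern_exp rho (size zs) phi)%:E * nu (agree A a))%E.
Proof.
elim: zs phi A a => [|z zs IH] phi A a /=.
  by move=> _ _; rewrite integral_cst.
case/andP=> zzs uzs disj.
have zA : z \notin A by apply: disj; rewrite mem_head.
have disj' y : y \in zs -> y \notin (z |` A)%fset.
  move=> yzs; rewrite !inE negb_or disj ?inE ?yzs ?orbT // andbT.
  by apply: contraNneq zzs => <-.
have E : agree A a = agree (z |` A)%fset (extend a z true) `|`
                     agree (z |` A)%fset (extend a z false).
  rewrite !agree_extend // -setIUr; apply/esym/setIidPl => eta _ /=.
  by case: (eta z); [left|right].
have half b :
    (\int[nu]_(eta in agree (z |` A)%fset (extend a z b)) (phi (eta z :: map eta zs))%:E =
     (bern_exp rho (size zs) (fun s => phi (b :: s)))%:E *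
     ((if b then rho else 1 - rho)%:E * nu (agree A a)))%E.
  rewrite -(nu_extend _ _ zA) -IH //; apply: eq_integral => eta.
  by rewrite inE agree_extend // => -[_ /= ->].
rewrite [X in integral _ X _]E integral_setU //.
- rewrite !half -(fineK (fin_num_measure nu _ (measurable_agree A a))).
  by rewrite -!EFinM -EFinD; congr EFin; ring.
- apply/measurable_EFinP; apply: measurable_funTS.
  exact: (measurable_local (z :: zs)).
- apply/disj_set2P; rewrite -subset0 => eta []; rewrite !agree_extend // => -[_ /= ->] [_] //.
Qed.

Lemma expectation_local (zs : seq Gam) (phi : seq bool -> R) : uniq zs ->
  ('E_nu[fun eta => phi (map eta zs)] = (bern_exp rho (size zs) phi)%:E)%E.
Proof.
move=> uzs; rewrite unlock.
have E : agree fset0 (fun=> true) = setT by apply/seteqP; split.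
rewrite -E integral_agree // E probability_setT mule1 //.
Qed.

(** Both sides are the [nu]-expectation of the same local function. *)
Lemma bern_exp_subset (zs ys : seq Gam) (phi : seq bool -> R) :
  uniq zs -> uniq ys -> {subset ys <= zs} ->
  bern_exp rho (size zs) (fun s => phi [seq nth false s (index y zs) | y <- ys]) =
  bern_exp rho (size ys) phi.
Proof.
move=> uzs uys sub; apply: EFin_inj; rewrite -!expectation_local //.
congr ('E_nu[_])%E; apply/funext => eta; congr phi.
apply/eq_in_map => y /sub yzs.
by rewrite (nth_map 1%g) ?index_mem // nth_index.
Qed.

End BernoulliProduct.

(** * Replacing fixed sites by random ones *)

Lemma sum_const_seq (R : realType) (I : Type) (s : seq I) (a : R) :
  \sum_(i <- s) a = (size s)%:R * a.
Proof. by rewrite big_const_seq count_predT iter_addr_0 mulr_natl. Qed.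

Lemma sum_count_mem (R : realType) (V : eqType) (s : seq V) v :
  \sum_(w <- s) (w == v)%:R = (count_mem v s)%:R :> R.
Proof.
by elim: s => [|w s IH]; rewrite ?big_nil // big_cons IH /= natrD.
Qed.

Section Replacement.
Variables (R : realType) (V : finType).
Local Notation X := {ffun V -> bool}.
Implicit Types (g : X -> R) (h : X -> R) (u v : V) (eta : X).

Definition fswap u v eta : X := [ffun z => swap u v eta z].

Definition sqnorm g : R := \sum_(eta : X) g eta ^+ 2.

(** The contribution of a single exchange to the Dirichlet form of [g]. *)
Definition exchange_energy g u v : R :=
  \sum_(eta : X) (g (fswap u v eta) - g eta) ^+ 2.

Definition density (sites : seq V) eta : R :=
  (size sites)%:R^-1 * \sum_(v <- sites) (eta v)%:R.

Lemma fswapxx u eta : fswap u u eta = eta.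
Proof. by apply/ffunP => z; rewrite ffunE /swap; case: eqP => // ->. Qed.

Lemma fswapL u v eta : fswap u v eta u = eta v.
Proof. by rewrite ffunE /swap eqxx. Qed.

Lemma fswapR u v eta : fswap u v eta v = eta u.
Proof. by rewrite ffunE /swap eqxx; case: eqP => // ->. Qed.

Lemma fswapN u v eta z : z != u -> z != v -> fswap u v eta z = eta z.
Proof. by rewrite ffunE /swap => /negPf -> /negPf ->. Qed.

Lemma fswapK u v : involutive (fswap u v).
Proof.
move=> eta; apply/ffunP => z.
have [->|zu] := eqVneq z u; first by rewrite fswapL fswapR.
have [->|zv] := eqVneq z v; first by rewrite fswapR fswapL.
by rewrite !fswapN.
Qed.

Lemma sum_fswap u v h : \sum_(eta : X) h (fswap u v eta) = \sum_(eta : X) h eta.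
Proof.
by rewrite [RHS](reindex_inj (inv_inj (fswapK u v))).
Qed.

Lemma sqnorm_ge0 g : 0 <= sqnorm g.
Proof. by apply: sumr_ge0 => eta _; exact: sqr_ge0. Qed.

Lemma exchange_energy_ge0 g u v : 0 <= exchange_energy g u v.
Proof. by apply: sumr_ge0 => eta _; exact: sqr_ge0. Qed.

(** Against the density [g ^+ 2], an exchange changes an expectation by
    [h * (g' - g) * (g' + g)], where [g'] is [g] after the exchange, which
    Young's inequality bounds by the energy of the exchange. *)
Lemma exchange_cost g u v h C beta : 0 <= C -> 0 < beta ->
  (forall eta, `|h eta| <= C) ->
  \sum_(eta : X) h eta * g eta ^+ 2 <=
  \sum_(eta : X) h (fswap u v eta) * g eta ^+ 2 +
  C * (beta * sqnorm g + exchange_energy g u v / beta).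
Proof.
move=> C0 b0 hC.
have bV0 : 0 < beta^-1 by rewrite invr_gt0.
have bb : beta * beta^-1 = 1 by rewrite divff // gt_eqF.
rewrite -(sum_fswap u v (fun eta => h (fswap u v eta) * _)).
have -> : \sum_(eta : X) h (fswap u v (fswap u v eta)) * g (fswap u v eta) ^+ 2
  = \sum_(eta : X) h eta * g (fswap u v eta) ^+ 2.
  by apply: eq_bigr => eta _; rewrite fswapK.
have E : sqnorm g = 2^-1 * sqnorm g + 2^-1 * \sum_(eta : X) g (fswap u v eta) ^+ 2.
  by rewrite (sum_fswap u v (fun eta => g eta ^+ 2)) -/(sqnorm g); lra.
rewrite {}E; set T := (leRHS).
have -> : T = \sum_(eta : X) (h eta * g (fswap u v eta) ^+ 2 +
    C * (beta * (2^-1 * g eta ^+ 2 + 2^-1 * g (fswap u v eta) ^+ 2) +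
         (g (fswap u v eta) - g eta) ^+ 2 / beta)).
  rewrite big_split /= -mulr_sumr big_split /= -mulr_sumr -mulr_suml.
  by rewrite big_split /= -!mulr_sumr.
apply: ler_sum => eta _.
set x := g eta; set y := g (fswap u v eta).
move: (hC eta); rewrite ler_norml => /andP[h1 h2].
have : h eta * (x ^+ 2 - y ^+ 2) <= C * `|x ^+ 2 - y ^+ 2|.
  apply: le_trans (ler_norm _) _; rewrite normrM; apply: ler_wpM2r => //.
have : `|x ^+ 2 - y ^+ 2| <=
    beta * (2^-1 * x ^+ 2) + beta * (2^-1 * y ^+ 2) + (y - x) ^+ 2 / beta.
  (* Young's inequality, for both signs of [x ^+ 2 - y ^+ 2] *)
  have key (a : R) : a = 1 \/ a = -1 -> a * (x ^+ 2 - y ^+ 2) <=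
     beta * (2^-1 * x ^+ 2) + beta * (2^-1 * y ^+ 2) + (y - x) ^+ 2 / beta.
    move=> a1; have aa : a ^+ 2 = 1 by case: a1 => ->; rewrite ?expr1n ?sqrrN ?expr1n.
    have : 0 <= beta^-1 * ((beta * (x + y) * 2^-1 - a * (x - y)) ^+ 2) +
       beta * 4^-1 * (x - y) ^+ 2.
      apply: addr_ge0; first by rewrite mulr_ge0 ?sqr_ge0 // ltW.
      by rewrite mulr_ge0 ?sqr_ge0 // mulr_ge0 ?invr_ge0 // ltW.
    have -> : beta^-1 * ((beta * (x + y) * 2^-1 - a * (x - y)) ^+ 2) +
       beta * 4^-1 * (x - y) ^+ 2 =
       beta * beta^-1 * beta * (x + y) ^+ 2 * 4^-1 - (beta * beta^-1) * a * (x + y) * (x - y)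
       + a ^+ 2 * ((y - x) ^+ 2 / beta) + beta * 4^-1 * (x - y) ^+ 2 by field; rewrite gt_eqF.
    by rewrite bb aa !mul1r; lra.
  rewrite ler_norml; apply/andP; split; last by have := key 1 (or_introl erefl); rewrite mul1r.
  by have := key (-1) (or_intror erefl); rewrite mulN1r; lra.
move=> /(ler_wpM2l C0); lra.
Qed.

Lemma density_bounds sites eta : 0 <= density sites eta <= 1.
Proof.
rewrite /density; apply/andP; split.
  by rewrite mulr_ge0 ?invr_ge0 // sumr_ge0.
have [->|s0] := eqVneq sites [::]; first by rewrite big_nil mulr0.
rewrite ler_pdivrMl ?ltr0n; last by case: sites s0.
rewrite mulr1 -sum1_size natr_sum; apply: ler_sum => v _.
by rewrite ler_nat; case: (eta v).
Qed.

Lemma density_mean sites eta (phi : bool -> R) : (0 < size sites)%N ->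
  (size sites)%:R^-1 * \sum_(v <- sites) phi (eta v) =
  density sites eta * phi true + (1 - density sites eta) * phi false.
Proof.
move=> s0; have M0 : (size sites)%:R != 0 :> R by rewrite pnatr_eq0 -lt0n.
have -> : \sum_(v <- sites) phi (eta v) = (size sites)%:R * phi false +
    (\sum_(v <- sites) (eta v)%:R) * (phi true - phi false).
  elim: sites {s0 M0} => [|v s IH]; first by rewrite !big_nil /= !mul0r add0r.
  by rewrite !big_cons IH /= -natr1; case: (eta v) => /=; ring.
rewrite /density; move: (\sum_(v <- _) _) => t; field.
exact: M0.
Qed.

(** An exchange alters the average occupation of [sites] only through the two
    vertices exchanged. *)
Lemma density_fswap sites u v eta theta : (0 < size sites)%N ->
  (forall w, (count_mem w sites)%:R <= theta * (size sites)%:R) ->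
  `|density sites (fswap u v eta) - density sites eta| <= 2 * theta.
Proof.
move=> s0 thetaP; rewrite /density -mulrBr -sumrB.
have M0 : 0 < (size sites)%:R :> R by rewrite ltr0n.
rewrite normrM ger0_norm ?invr_ge0 // ler_pdivrMl //.
apply: le_trans (ler_norm_sum _ _ _) _.
apply: (@le_trans _ _ (\sum_(w <- sites) ((w == u)%:R + (w == v)%:R))).
  apply: ler_sum => w _.
  have [->|wu] := eqVneq w u.
    rewrite -natrD; case: (fswap _ _ _ _); case: (eta _); rewrite ?subrr ?subr0 ?sub0r ?normrN ?normr0 ?normr1 ?ler0n ?ler1n //.
  have [->|wv] := eqVneq w v.
    rewrite -natrD; case: (fswap _ _ _ _); case: (eta _); rewrite ?subrr ?subr0 ?sub0r ?normrN ?normr0 ?normr1 ?ler0n ?ler1n //.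
  by rewrite fswapN // subrr normr0 addr0.
rewrite big_split /=.
rewrite !sum_count_mem; have := thetaP u; have := thetaP v; lra.
Qed.

(** The sites [rest] are replaced one at a time by independent uniform samples
    from [sites]; [pre] collects the samples already drawn.  Exchanging [z]
    with its sample [v] realises the replacement unless [v] hits a site that is
    still in use, which has probability at most [k * theta]; that [pre] stays
    disjoint from [rest] keeps the exchange from disturbing earlier samples.
    Once nothing is left, the values read are independent Bernoulli variables
    whose parameter is the density of [sites]. *)
Lemma replacement g (h : seq bool -> R -> R) sites theta C Lp beta k :
  0 <= C -> 0 <= Lp -> 0 < beta -> (0 < size sites)%N ->
  (forall w, (count_mem w sites)%:R <= theta * (size sites)%:R) ->
  (forall s p, 0 <= p <= 1 -> `|h s p| <= C) ->
  (forall s p p', 0 <= p <= 1 -> 0 <= p' <= 1 ->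
     `|h s p - h s p'| <= Lp * `|p - p'|) ->
  forall rest pre, uniq rest -> ~~ has (mem pre) rest ->
  (size pre + size rest <= k)%N ->
  \sum_(eta : X) h (map eta (pre ++ rest)) (density sites eta) * g eta ^+ 2 <=
  \sum_(eta : X) bern_exp (density sites eta) (size rest)
     (fun s => h (map eta pre ++ s) (density sites eta)) * g eta ^+ 2 +
  (size rest)%:R * ((2 * theta * Lp + 2 * C * k%:R * theta + C * beta) * sqnorm g) +
  C / beta * \sum_(z <- rest)
    (size sites)%:R^-1 * \sum_(v <- sites) exchange_energy g z v.
Proof.
move=> C0 Lp0 b0 s0 thetaP hC hL.
have M0 : 0 < (size sites)%:R :> R by rewrite ltr0n.
have rho01 := density_bounds sites.
have g0 := sqnorm_ge0 g.
elim=> [|z rest IH] pre /=.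
  by move=> _ _ _; rewrite big_nil mul0r mulr0 !addr0; apply: ler_sum => eta _; rewrite !cats0.
case/andP => zr ur; rewrite negb_or => /andP[zp disj] szk.
set A := leLHS.
pose B v := \sum_(eta : X) bern_exp (density sites eta) (size rest)
     (fun s => h (map eta (rcons pre v) ++ s) (density sites eta)) * g eta ^+ 2.
pose bad v := (v \in pre) || (v \in rest).
set err := (2 * theta * Lp + 2 * C * k%:R * theta + C * beta) * sqnorm g.
pose D := \sum_(w <- rest)
  (size sites)%:R^-1 * \sum_(v <- sites) exchange_energy g w v.
have th0 : 0 <= theta.
  by have := le_trans (ler0n R _) (thetaP z); rewrite pmulr_lge0.
have err0 : 0 <= err.
  by apply: mulr_ge0 => //; rewrite !addr_ge0 ?mulr_ge0 // ltW.
have D0 : 0 <= D.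
  apply: sumr_ge0 => w _; rewrite mulr_ge0 ?invr_ge0 ?sumr_ge0 // => v _.
  exact: exchange_energy_ge0.
have boundE phi : (forall eta, `|phi eta| <= C) ->
    `|\sum_(eta : X) phi eta * g eta ^+ 2| <= C * sqnorm g.
  move=> le; apply: le_trans (ler_norm_sum _ _ _) _; rewrite mulr_sumr.
  apply: ler_sum => eta _; rewrite normrM (ger0_norm (sqr_ge0 _)).
  by rewrite ler_wpM2r // sqr_ge0.
have Bbound v : - (C * sqnorm g) <= B v.
  have /ler_normlP[+ _] : `|B v| <= C * sqnorm g.
    by apply: boundE => eta; apply: bern_exp_norm => // s; apply: hC.
  by rewrite lerNl.
have Abound : A <= C * sqnorm g.
  by have /ler_normlP[] : `|A| <= C * sqnorm g by apply: boundE => eta; apply: hC.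
have step v : A <= B v + (bad v)%:R * (2 * C * sqnorm g) +
    (2 * theta * Lp + C * beta) * sqnorm g + C / beta * exchange_energy g z v +
    (size rest)%:R * err + C / beta * D.
  have cE : 0 <= C / beta * exchange_energy g z v.
    by rewrite mulr_ge0 ?exchange_energy_ge0 // divr_ge0 // ltW.
  have cD : 0 <= C / beta * D by rewrite mulr_ge0 // divr_ge0 // ltW.
  have ce : 0 <= (size rest)%:R * err by rewrite mulr_ge0.
  have ct : 0 <= (2 * theta * Lp + C * beta) * sqnorm g.
    by rewrite mulr_ge0 // addr_ge0 ?mulr_ge0 // ltW.
  have [bv|] := boolP (bad v); first by have := Bbound v; rewrite mul1r; lra.
  rewrite /bad negb_or => /andP[vp vr]; rewrite mul0r addr0.
  have disj' : ~~ has (mem (rcons pre v)) rest.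
    apply/hasPn => w wr; rewrite /= mem_rcons inE negb_or.
    rewrite (hasPn disj _ wr) andbT; apply: contraNneq vr => <- //.
  have szk' : (size (rcons pre v) + size rest <= k)%N.
    by rewrite size_rcons addSn -addnS.
  have := IH (rcons pre v) ur disj' szk'; rewrite -/err -/D -/(B v).
  set A' := leLHS => hA'.
  suff : A <= A' + 2 * theta * Lp * sqnorm g + C * (beta * sqnorm g + exchange_energy g z v / beta).
    by move: hA'; lra.
  have := @exchange_cost g z v (fun eta => h (map eta (pre ++ z :: rest)) (density sites eta)) C beta C0 b0.
  move=> /(_ (fun eta => hC _ _ (rho01 eta))) /le_trans; apply.
  rewrite lerD2r; rewrite /A' /sqnorm mulr_sumr -big_split /=.
  apply: ler_sum => eta _; rewrite -mulrDl ler_wpM2r ?sqr_ge0 //.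
  have -> : map (fswap z v eta) (pre ++ z :: rest) = map eta (rcons pre v ++ rest).
    rewrite cat_rcons !map_cat /= fswapL; congr (_ ++ _ :: _).
      apply/eq_in_map => w wp; rewrite fswapN //; first by apply: contraNneq zp => <-.
      by apply: contraNneq vp => <-.
    apply/eq_in_map => w wp; rewrite fswapN //; first by apply: contraNneq zr => <-.
    by apply: contraNneq vr => <-.
  have := hL (map eta (rcons pre v ++ rest)) _ _ (rho01 (fswap z v eta)) (rho01 eta).
  have := ler_wpM2l Lp0 (density_fswap z v eta s0 thetaP).
  set x := h _ _; set y := h _ _; move=> h1 h2.
  by have := le_trans (ler_norm _) (le_trans h2 h1); lra.
have badsum : \sum_(v <- sites) (bad v)%:R <= k%:R * theta * (size sites)%:R.
  apply: (@le_trans _ _ (\sum_(v <- sites) \sum_(w <- pre ++ rest) (v == w)%:R)).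
    apply: ler_sum => v _; rewrite /bad -mem_cat.
    have [vin|] := boolP (v \in pre ++ rest); last by move=> _; apply: sumr_ge0.
    rewrite (big_rem v) //= eqxx lerDl; exact: sumr_ge0.
  rewrite exchange_big /=.
  apply: (@le_trans _ _ (\sum_(w <- pre ++ rest) theta * (size sites)%:R)).
    apply: ler_sum => w _; apply: le_trans (thetaP w).
    by rewrite sum_count_mem.
  rewrite sum_const_seq -mulrA ler_wpM2r ?mulr_ge0 //.
  by rewrite ler_nat size_cat; apply: leq_trans szk; rewrite leq_add2l.
have Bsum : (size sites)%:R^-1 * \sum_(v <- sites) B v =
  \sum_(eta : X) bern_exp (density sites eta) (size rest).+1
     (fun s => h (map eta pre ++ s) (density sites eta)) * g eta ^+ 2.
  rewrite exchange_big mulr_sumr /=; apply: eq_bigr => eta _.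
  rewrite -mulr_suml mulrA; congr (_ * _).
  have /= <- := (density_mean eta (fun b => bern_exp (density sites eta) (size rest)
     (fun s => h (map eta (pre) ++ b :: s) (density sites eta))) s0).
  congr (_ * _); apply: eq_bigr => v _; apply: eq_bern_exp => s.
  by rewrite map_rcons cat_rcons.
rewrite big_cons -/D.
have : (size sites)%:R * A <= \sum_(v <- sites) (B v + (bad v)%:R * (2 * C * sqnorm g) +
    C / beta * exchange_energy g z v +
    ((2 * theta * Lp + C * beta) * sqnorm g + (size rest)%:R * err + C / beta * D)).
  rewrite -sum_const_seq.
  by apply: ler_sum => v _; have := step v; lra.
rewrite !big_split /= -mulr_suml -mulr_sumr !sum_const_seq.
rewrite -ler_pdivlMl // => /le_trans; apply.
have K0 : 0 <= 2 * C * sqnorm g by rewrite !mulr_ge0.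
have hb := ler_wpM2r K0 badsum.
have MM : (size sites)%:R^-1 * (size sites)%:R = 1 :> R by rewrite mulVf ?gt_eqF.
rewrite /= in Bsum; rewrite -{}Bsum.
set K := 2 * C * sqnorm g in hb *.
set e1 := (2 * theta * Lp + C * beta) * _.
set e2 := (size rest)%:R * err; set e3 := C / beta * D.
rewrite 5!(mulrDr _^-1) !(mulrA _^-1 (size sites)%:R) MM !mul1r.
have {}hb : (size sites)%:R^-1 * ((\sum_(v <- sites) (bad v)%:R) * K) <=
   k%:R * theta * K.
  by rewrite ler_pdivrMl // (le_trans hb) // le_eqVlt; apply/orP; left; apply/eqP; ring.
rewrite (mulrCA _^-1 (C / beta)) -(natr1 (size rest)) (mulrDr (C / beta)).
rewrite -/e3 [X in _ <= _ + X + _]mulrDl -/e2 mul1r.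
rewrite /K in hb *; rewrite /e1 {1}/err; lra.
Qed.

End Replacement.

(** * Cosets, balls and Foelner sets *)

Section Cosets.
Variables (Gam : groupType) (N : finite_index_normal Gam).
Implicit Types (x y g : Gam) (q : quot N).

Lemma orbit_eqP x y : Defs.orbit N x = Defs.orbit N y <-> (N : set Gam) (x^-1 * y)%g.
Proof.
have [N1 NM NV] := fin_subgroup N; have Nn : is_normal N := @fin_isnormal _ N.
split=> [E|Nxy].
  have : Defs.orbit N y y by exists 1%g; rewrite ?mul1g.
  rewrite -E => -[g Ng <-]; have := Nn (x^-1)%g g Ng.
  by rewrite invgK mulgA.
have Nyx : (N : set Gam) (y * x^-1)%g.
  by have := Nn x _ Nxy; rewrite mulgA mulgV mul1g.
apply/seteqP; split => _ [g Ng <-].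
  exists (g * (y * x^-1)^-1)%g; first by apply: NM => //; apply: NV.
  by rewrite invgM invgK -!mulgA mulVg mulg1.
exists (g * (y * x^-1))%g; first exact: NM.
by rewrite -!mulgA mulVg mulg1.
Qed.

Lemma proj_eqP x y : Defs.proj N x = Defs.proj N y <-> (N : set Gam) (x^-1 * y)%g.
Proof.
rewrite -orbit_eqP; split=> [/(congr1 val) //|E].
by apply: val_inj.
Qed.

Lemma lift_quotK q : Defs.proj N (lift_quot q) = q.
Proof.
have := valP q; rewrite in_fset_set ?inE; last exact: fin_finite.
case=> x _ E; apply: val_inj => /=; rewrite -E; apply/orbit_eqP.
have ex : exists y, (val q : set Gam) y.
  by exists x; rewrite -E; exists 1%g; [case: (fin_subgroup N)|rewrite mul1g].
have := xgetPex 1%g ex; rewrite -/(lift_quot q) -E => -[g Ng <-].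
have [_ _ NV] := fin_subgroup N.
by have := fin_isnormal (x^-1)%g (NV _ Ng); rewrite invgK invgM.
Qed.

Lemma proj_mulgr x y g : Defs.proj N (x * g)%g = Defs.proj N (y * g)%g <-> Defs.proj N x = Defs.proj N y.
Proof.
rewrite !proj_eqP; have -> : ((x * g)^-1 * (y * g) = g^-1 * (x^-1 * y) * g)%g.
  by rewrite invgM !mulgA.
split=> [/(fin_isnormal g)|/(fin_isnormal (g^-1)%g)].
  by rewrite !mulgA mulgV mul1g -!mulgA mulgV mulg1.
by rewrite invgK.
Qed.

Lemma proj_mulgl x y g : Defs.proj N (g * x)%g = Defs.proj N (g * y)%g <-> Defs.proj N x = Defs.proj N y.
Proof. by rewrite !proj_eqP invgM -mulgA mulKg. Qed.

Lemma translate_inj g : injective (fun q => Defs.proj N (lift_quot q * g)%g).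
Proof. by move=> q q' /proj_mulgr; rewrite !lift_quotK. Qed.

End Cosets.

Section Walks.
Variables (Gam : groupType) (S : {fset Gam}).
Hypotheses (S_symmetric : symmetric_set S) (S_generates : generated_by S).
Local Notation adj := (cayley_adj S).
Local Notation gd := (gdist (cayley_adj S)).

Lemma walk_mulg g n x y : walk adj n x y -> walk adj n (g * x)%g (g * y)%g.
Proof.
elim: n x => [|n IH] x /=; first by move->.
case=> z [s sS /= ->] /IH; exists (g * (x * s))%g => //.
by exists s; rewrite //= mulgA.
Qed.

Lemma walk_cat n m x y z : walk adj n x y -> walk adj m y z ->
  walk adj (n + m) x z.
Proof.
elim: n x => [|n IH] x /=; first by move->.
by case=> u xu uy yz; exists u => //; exact: IH.
Qed.

Lemma walk_rev n x y : walk adj n x y -> walk adj n y x.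
Proof.
elim: n x => [|n IH] x /=; first by move->.
case=> z [s sS /= ez] /IH yz.
suff : walk adj (n + 1) y x by rewrite addn1.
apply: (walk_cat yz) => /=; exists x => //.
by exists (s^-1)%g; [exact: S_symmetric|rewrite /= ez mulgK].
Qed.

Lemma walk_connected x y : exists n, walk adj n x y.
Proof.
have : [set g | exists n, walk adj n 1%g g] = setT.
  apply: S_generates; last first.
    move=> s sS /=; exists 1%N; rewrite /=; exists s => //.
    by exists s; rewrite //= mul1g.
  split=> [|g h [n wg] [m wh]|g [n wg]] /=; first by exists 0%N.
    exists (n + m)%N; apply: (walk_cat wg).
    by have := walk_mulg g wh; rewrite mulg1.
  by exists n; apply: walk_rev; have := walk_mulg (g^-1)%g wg; rewrite mulg1 mulVg.
move=> /seteqP[_ /(_ (x^-1 * y)%g I)] [n w]; exists n.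
by have := walk_mulg x w; rewrite mulg1 mulgA mulgV mul1g.
Qed.

Lemma gdist_walk x y : walk adj (gd x y) x y.
Proof.
have [n0 w0] := walk_connected x y.
pose p n := `[< walk adj n x y >].
have ex : exists n, p n by exists n0; exact/asboolP.
case: (ex_minnP ex) => n /asboolP wn nmin.
have : exists n, [set n | walk adj n x y /\ forall k, walk adj k x y -> (n <= k)%N] n.
  by exists n; split=> // k wk; apply: nmin; exact/asboolP.
by case/(xgetPex 0%N).
Qed.

Lemma cball_finite (R : realType) x (r : R) : exists2 l : seq Gam, uniq l &
  forall z, cball S x r z -> z \in l.
Proof.
pose fix W (n : nat) (y : Gam) {struct n} : seq Gam :=
  if n is k.+1 then flatten [seq W k (y * s)%g | s <- S] else [:: y].
have WP n y z : walk adj n y z -> z \in W n y.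
  elim: n y => [|n IH] y /=; first by move->; rewrite inE.
  case=> u [s sS /= ->] /IH zW; apply/flattenP.
  by exists (W n (y * s)%g) => //; apply/mapP; exists s.
exists (undup (flatten [seq W n x | n <- iota 0 (Num.truncn r).+1])).
  exact: undup_uniq.
move=> z zr; rewrite mem_undup; apply/flattenP.
exists (W (gd x z) x); last exact/WP/gdist_walk.
apply/mapP; exists (gd x z) => //; rewrite mem_iota add0n ltnS leq0n andTb.
by rewrite truncn_ge_nat //; apply: le_trans zr.
Qed.

End Walks.

Section Folner.
Variables (R : realType) (Gam : groupType) (S : {fset Gam}).
Hypotheses (Gam_infinite : infinite_set [set: Gam]).
Hypotheses (S_symmetric : symmetric_set S) (S_generates : generated_by S).
Variable F : nat -> {fset Gam}.
Hypothesis F_folner : folner R S F.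
Local Open Scope fset_scope.

Definition rtranslate (A : {fset Gam}) (g : Gam) : {fset Gam} :=
  [fset (x * g)%g | x in A].

Lemma card_rtranslate A g : #|` rtranslate A g| = #|` A|.
Proof. by rewrite card_imfset //= => x y /mulIg. Qed.

Definition escape A g : nat := #|` rtranslate A g `\` A|.

Lemma escapeM A g h : (escape A (g * h)%g <= escape A g + escape A h)%N.
Proof.
rewrite /escape -(card_rtranslate (rtranslate A g `\` A) h).
apply: leq_trans (leq_card_fsetU _ _).
apply/fsubset_leq_card/fsubsetP => z; rewrite !inE => /andP[zA /imfsetP[x /= xA ze]].
have [xgA|xgA] := boolP ((x * g)%g \in A).
  apply/orP; right; rewrite zA; apply/imfsetP; exists (x * g)%g => //=.
  by rewrite ze mulgA.
apply/orP; left; apply/imfsetP; exists (x * g)%g; last by rewrite ze mulgA.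
by rewrite !inE xgA; apply/imfsetP; exists x.
Qed.

Lemma escapeV A g : escape A (g^-1)%g = escape A g.
Proof.
have E : rtranslate (A `\` rtranslate A g) (g^-1)%g = rtranslate A (g^-1)%g `\` A.
  apply/fsetP => z; rewrite !inE; apply/imfsetP/andP => /=.
    case=> x; rewrite !inE => /andP[xg xA] ->; split.
      apply: contra xg => xgA; apply/imfsetP; exists (x * g^-1)%g => //=.
      by rewrite mulgVK.
    by apply/imfsetP; exists x.
  case=> zA /imfsetP[x /= xA ze]; exists x => //; rewrite !inE xA andbT.
  apply: contra zA => /imfsetP[y /= yA xe].
  by rewrite ze xe mulgK.
rewrite /escape -E card_rtranslate !cardfsD card_rtranslate fsetIC.
by [].
Qed.

(** The elements whose right translation is absorbed in the limit form a
    subgroup, and it contains the generators. *)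
Lemma escape_cvg g : (fun i => (escape (F i) g)%:R / #|` F i|%:R : R) @ \oo --> (0 : R).
Proof.
have [_ Fb] := F_folner.
have : [set g | (fun i => (escape (F i) g)%:R / #|` F i|%:R : R) @ \oo --> (0 : R)] = setT.
  apply: S_generates.
    split.
    - rewrite /=; under eq_fun => i.
        rewrite /escape (_ : rtranslate _ _ = F i) ?fsetDv ?cardfs0 ?mul0r; last first.
          apply/fsetP => z; apply/imfsetP/idP => /= [[x xA ->]|zF]; first by rewrite mulg1.
          by exists z; rewrite ?mulg1.
      over.
      exact: cvg_cst.
    - move=> x y /= cx cy; have cxy : (fun i => (escape (F i) x)%:R / #|` F i|%:R +
          (escape (F i) y)%:R / #|` F i|%:R : R)%R @ \oo --> (0 : R).
        by rewrite -[X in _ --> X]addr0; exact: cvgD.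
      apply: (squeeze_cvgr _ (cvg_cst (0 : R)) cxy).
      apply: nearW => i; rewrite divr_ge0 //=.
      by rewrite -mulrDl ler_wpM2r ?invr_ge0 // -natrD ler_nat escapeM.
    - move=> x /=.
      suff -> : (fun i => (escape (F i) (x^-1)%g)%:R / #|` F i|%:R : R) =
        (fun i => (escape (F i) x)%:R / #|` F i|%:R) by [].
      by apply/funext => i; rewrite escapeV.
  move=> s sS /=; apply: (squeeze_cvgr _ (cvg_cst (0 : R)) Fb).
  apply: nearW => i; rewrite divr_ge0 //= ler_wpM2r ?invr_ge0 // ler_nat.
  apply/fsubset_leq_card/fsetSD/fsubsetP => z /imfsetP[x /= xF ->].
  by apply/imfset2P; exists x => //; exists s.
by move=> /seteqP[_ /(_ g I)].
Qed.

Local Close Scope fset_scope.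

Variable G : nat -> finite_index_normal Gam.
Hypothesis G_descending : forall i, G i.+1 `<=` G i.
Hypothesis G_separates :
  \bigcap_(i in [set i | (1 <= i)%N]) (G i : set Gam) = [set 1%g].

Lemma avoid_subgroups (l : seq Gam) : exists m0, forall m, (m0 <= m)%N ->
  forall g, g \in l -> (G m : set Gam) g -> g = 1%g.
Proof.
have mono i j : (i <= j)%N -> G j `<=` G i.
  move=> /subnKC <-; elim: (j - i)%N => [|n IH]; first by rewrite addn0.
  by rewrite addnS => g /G_descending /IH.
elim: l => [|g l [m0 IH]]; first by exists 0%N.
have [->|g1] := eqVneq g 1%g.
  by exists m0 => m mm x; rewrite inE => /orP[/eqP //|xl]; exact: IH.
have [m1 m1P] : exists m1, ~ (G m1 : set Gam) g.
  apply: contrapT => nex; move/eqP: g1; apply.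
  have : (\bigcap_(i in [set i | (1 <= i)%N]) (G i : set Gam)) g.
    by move=> i _; apply: contrapT => ng; apply: nex; exists i.
  by rewrite G_separates.
exists (maxn m0 m1) => m; rewrite geq_max => /andP[mm0 mm1] x.
rewrite inE => /orP[/eqP -> Gg|xl]; last exact: IH.
by case: m1P; exact: mono Gg.
Qed.

(** A Foelner set meets each coset of a deep subgroup in a small proportion:
    if [k] fixed elements lie in distinct cosets, the right translates of such
    an intersection by them are disjoint and almost contained in the set. *)
Lemma coset_fraction (kappa : R) : 0 < kappa -> exists i0 m0 : nat,
  forall i m, (i0 <= i)%N -> (m0 <= m)%N -> forall E : seq Gam, uniq E ->
  {subset E <= F i} -> {in E &, forall x y, Defs.proj (G m) x = Defs.proj (G m) y} ->
  (size E)%:R <= kappa * #|` F i|%:R.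
Proof.
move=> kappa0; have [Fne _] := F_folner.
pose k := (Num.truncn (2 / kappa)).+1.
have k2 : 2 <= kappa * k%:R.
  rewrite -ler_pdivrMl // mulrC ltW // /k.
  by apply: truncnS_gt.
have [gs _ gsk] := infinite_set_fset k Gam_infinite.
have [m0 m0P] := avoid_subgroups [seq (g * h^-1)%g | g <- gs, h <- gs].
have sum0 (l : seq Gam) :
    (fun i => \sum_(g <- l) ((escape (F i) g)%:R / #|` F i|%:R : R)) @ \oo --> (0 : R).
  elim: l => [|g l IH].
    by under eq_fun do rewrite big_nil; exact: cvg_cst.
  have -> : (fun i => \sum_(g <- g :: l) ((escape (F i) g)%:R / #|` F i|%:R : R)) =
      (fun i => (escape (F i) g)%:R / #|` F i|%:R +
        \sum_(g <- l) ((escape (F i) g)%:R / #|` F i|%:R)).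
    by apply/funext => i; rewrite big_cons.
  have := @cvgD _ _ _ \oo _ _ _ _ _ (escape_cvg g) IH.
  by rewrite addr0 => cv; exact: cv.
have /cvgr_lt/(_ _ (@ltr01 R)) [i0 _ i0P] := sum0 gs.
exists (maxn 1 i0), m0 => i m; rewrite geq_max => /andP[i1 ii0] mm0 E uE EF Ep.
have F0 : 0 < #|` F i|%:R :> R by rewrite ltr0n cardfs_gt0 Fne.
pose s1 := [seq (x * g)%g | x <- E, g <- gs].
pose s2 := (F i : seq Gam) ++ flatten [seq ((rtranslate (F i) g `\` F i)%fset : seq Gam) | g <- gs].
have us1 : uniq s1.
  apply: allpairs_uniq => //.
  move=> [x g] [y h] /allpairsP[[x' g'] /= [xE gG [-> ->]]] /allpairsP[[y' h'] /= [yE hG [-> ->]]] /= e.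
  have /proj_eqP := Ep _ _ xE yE => Gxy.
  have e2 : (x'^-1 * y' = g' * h'^-1)%g.
    by rewrite -(mulgK h' y') -e !mulgA mulVg mul1g.
  have gh : (g' * h'^-1 = 1)%g.
    by apply: (m0P m mm0); [apply/allpairsP; exists (g', h')|rewrite -e2].
  have gh' : g' = h' by rewrite -(mulgVK h' g') gh mul1g.
  by move: e; rewrite gh' => /mulIg ->.
have s12 : {subset s1 <= s2}.
  move=> _ /allpairsP[[x g] /= [xE gG ->]]; rewrite mem_cat.
  have [//|nF] := boolP ((x * g)%g \in F i); apply/flattenP.
  exists ((rtranslate (F i) g `\` F i)%fset : seq Gam); first by apply/mapP; exists g.
  by rewrite inE nF; apply/imfsetP; exists x => //=; exact: EF.
have := uniq_leq_size us1 s12.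
rewrite size_allpairs size_cat size_flatten /shape -map_comp sumnE big_map /=.
rewrite -(ler_nat R) natrM natrD natr_sum => le.
have := i0P i ii0 => /=; rewrite -mulr_suml ltr_pdivrMr // mul1r => lt.
have {}le : (size E)%:R * (size gs)%:R <= 2 * #|` F i|%:R :> R.
  apply: le_trans le _; have := ltW lt; rewrite /escape; lra.
have kgs : k%:R <= (size gs)%:R :> R by rewrite ler_nat.
have k0 : 0 < k%:R :> R by rewrite ltr0n.
have : (size E)%:R * k%:R <= kappa * #|` F i|%:R * k%:R.
  apply: le_trans (_ : (size E)%:R * (size gs)%:R <= _); first by rewrite ler_wpM2l.
  by apply: le_trans le _; rewrite mulrAC ler_wpM2r.
by rewrite ler_pM2r.
Qed.

(** A single point is the intersection with its own coset. *)
Lemma folner_card (kappa : R) : 0 < kappa -> exists2 i0, (1 <= i0)%N &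
  forall i, (i0 <= i)%N -> 1 <= kappa * #|` F i|%:R.
Proof.
move=> /coset_fraction[i0 [m0 P]]; have [Fne _] := F_folner.
exists (maxn 1 i0); first by rewrite leq_max.
move=> i; rewrite geq_max => /andP[i1 ii0].
have /fset0Pn[x xF] := Fne i i1.
apply: (P i m0 ii0 (leqnn _) [:: x]) => //.
  by move=> y; rewrite inE => /eqP ->.
by move=> y z; rewrite !inE => /eqP -> /eqP ->.
Qed.

(** The maximum exists because balls are finite while the sizes of the [F i]
    tend to infinity. *)
Lemma largest_insideP (o : Gam) (b0 : nat) : exists K0 : R, forall K, K0 <= K ->
  let b := largest_inside S o F K in
  (b0 <= b)%N /\ forall i, (1 <= i <= b)%N -> [set` F i] `<=` cball S o K.
Proof.
pose gd := gdist (cayley_adj S).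
exists ((\max_(i < b0.+1) \max_(x <- F i) gd o x)%:R) => K K0 b.
pose inside L := forall i, (1 <= i <= L)%N -> [set` F i] `<=` cball S o K.
have ib0 : inside b0.
  move=> i /andP[i1 ib] x xF; rewrite /cball /=; apply: le_trans K0.
  rewrite ler_nat; apply: leq_trans (leq_bigmax (Ordinal (ib : (i < b0.+1)%N))) => /=.
  by apply: leq_bigmax_seq.
have [l ul lP] := @cball_finite Gam S S_symmetric S_generates R o K.
have [i1 i11 i1P] : exists2 i1, (1 <= i1)%N & (size l < #|` F i1|)%N.
  have s0 : 0 < ((size l).+1%:R)^-1 :> R by rewrite invr_gt0.
  have [i1 i11 i1P] := folner_card s0; exists i1 => //.
  by have := i1P i1 (leqnn _); rewrite ler_pdivlMl // mulr1 ler_nat.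
have ub L : inside L -> (L <= i1)%N.
  move=> iL; rewrite leqNgt; apply/negP => i1L.
  have : (size (F i1) <= size l)%N.
    apply: uniq_leq_size; first exact: fset_uniq.
    by move=> x xF; apply: lP; apply: (iL i1) => //; rewrite i11 ltnW.
  by rewrite leqNgt i1P.
have ex : exists L, `[< inside L >] by exists b0; exact/asboolP.
have ub' L : `[< inside L >] -> (L <= i1)%N by move=> /asboolP; exact: ub.
case: (ex_maxnP ex ub') => L /asboolP iL Lmax.
have : exists L, [set L | inside L /\ forall L', inside L' -> (L' <= L)%N] L.
  by exists L; split=> // L' iL'; apply: Lmax; exact/asboolP.
case/(xgetPex 0%N) => ib bmax; split; last exact: ib.
exact: bmax.
Qed.

End Folner.

(** * The Dirichlet form of the exclusion process *)

Section Dirichlet.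
Variables (R : realType) (Gam : groupType) (S : {fset Gam}).
Variable N : finite_index_normal Gam.
Local Notation V := (quot N).
Local Notation X := {ffun V -> bool}.
Implicit Types (g : X -> R) (e : quot_edge S N).

Lemma sum_injective_le (A B : finType) (phi : A -> B) (w : B -> R) :
  injective phi -> (forall b, 0 <= w b) ->
  \sum_(a : A) w (phi a) <= \sum_(b : B) w b.
Proof.
move=> inj w0; rewrite -(big_imset w) /=; last by move=> a b _ _; exact: inj.
by rewrite [leRHS](bigID (mem (phi @: A)%SET)) /= lerDl sumr_ge0.
Qed.

(** By the identity of transpositions (a c) = (a b) (b c) (a b), the square
    roots of the energies satisfy a triangle inequality in which (a b) counts
    twice.  The weight [k] of Young's inequality is left free, to be matched to
    the length of the rest of a path. *)
Lemma exchange_triangle (U : finType) (h : {ffun U -> bool} -> R) (a b c : U) (k : R) :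
  0 < k ->
  exchange_energy h a c <=
  (k + 1) * (4 * exchange_energy h a b + exchange_energy h b c / k).
Proof.
move=> k0; have Eab := exchange_energy_ge0 h a b; have Ebc := exchange_energy_ge0 h b c.
have k10 : 0 < k + 1 by rewrite addr_gt0.
have rhs0 : 0 <= (k + 1) * (4 * exchange_energy h a b + exchange_energy h b c / k).
  by apply: mulr_ge0; [exact: ltW|apply: addr_ge0; [exact: mulr_ge0|apply: divr_ge0 => //; exact: ltW]].
have [ac|ac] := eqVneq a c.
  subst c; apply: le_trans rhs0; rewrite le_eqVlt; apply/orP; left; apply/eqP.
  by rewrite /exchange_energy big1 // => eta _; rewrite fswapxx subrr expr0n.
have [bc|bc] := eqVneq b c.
  subst c.
  apply: (@le_trans _ _ ((k + 1) * (4 * exchange_energy h a b))).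
    by have := mulr_ge0 (ltW k0) Eab; lra.
  by rewrite ler_pM2l // lerDl divr_ge0 ?exchange_energy_ge0 // ltW.
have swapE eta : fswap a c eta = fswap a b (fswap b c (fswap a b eta)).
  apply/ffunP => z; have ca : c != a by rewrite eq_sym.
  have cb : c != b by rewrite eq_sym.
  have [->|za] := eqVneq z a; first by rewrite !fswapL fswapN.
  have [->|zc] := eqVneq z c.
    by rewrite fswapR fswapN // fswapR fswapR.
  have [zb|zb] := eqVneq z b; last by rewrite !fswapN.
  by rewrite zb in za zc *; rewrite fswapN // fswapR fswapN 1?eq_sym // fswapL.
have -> : (k + 1) * (4 * exchange_energy h a b + exchange_energy h b c / k) =
  \sum_(eta : {ffun U -> bool}) (k + 1) *
   (2 * (h (fswap a b eta) - h eta) ^+ 2 +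
    2 * (h (fswap a b (fswap b c (fswap a b eta))) - h (fswap b c (fswap a b eta))) ^+ 2 +
    (h (fswap b c (fswap a b eta)) - h (fswap a b eta)) ^+ 2 / k).
  rewrite -mulr_sumr !big_split /= -!mulr_sumr -mulr_suml.
  rewrite (sum_fswap a b (fun eta => (h (fswap a b (fswap b c eta)) - h (fswap b c eta)) ^+ 2)).
  rewrite (sum_fswap b c (fun eta => (h (fswap a b eta) - h eta) ^+ 2)).
  rewrite (sum_fswap a b (fun eta => (h (fswap b c eta) - h eta) ^+ 2)).
  rewrite -/(exchange_energy h a b) -/(exchange_energy h b c); congr (_ * _); lra.
apply: ler_sum => eta _; rewrite swapE.
set u := h (fswap a b (fswap b c _)) - _ in rhs0 *.
set x := h (fswap a b eta) - h eta.
set y := h (fswap a b _) - h (fswap b c _).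
set v := h (fswap b c _) - h (fswap a b eta).
have -> : u = x + v + y by rewrite /u /x /v /y; ring.
have kk : k * k^-1 = 1 by rewrite divff // gt_eqF.
have : 0 <= k^-1 * (k * (x + y) - v) ^+ 2 + (k + 1) * (x - y) ^+ 2.
  by apply: addr_ge0; apply: mulr_ge0; rewrite ?sqr_ge0 ?invr_ge0 ?ltW.
have -> : k^-1 * (k * (x + y) - v) ^+ 2 =
  k * k^-1 * k * (x + y) ^+ 2 - 2 * (k * k^-1) * (x + y) * v + v ^+ 2 / k by ring.
have -> : (k + 1) * (2 * x ^+ 2 + 2 * y ^+ 2 + v ^+ 2 / k) =
   (k + 1) * (2 * x ^+ 2 + 2 * y ^+ 2) + (k * k^-1) * v ^+ 2 + v ^+ 2 / k by ring.
rewrite kk; lra.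
Qed.

Lemma edge_orbit_quot x s : s \in S ->
  edge_orbit N (x, (x * s)%g) \in fset_set (edge_orbit N @` edges S).
Proof.
move=> sS; rewrite in_fset_set ?inE; last exact: finite_edge_orbits.
by exists (x, (x * s)%g) => //; exists s.
Qed.

Lemma lift_edgeP e x y : val e = edge_orbit N (x, y) ->
  exists2 n, (N : set Gam) n & lift_edge e = ((n * x)%g, (n * y)%g).
Proof.
move=> ev; have ex : exists p, (val e : set (Gam * Gam)) p.
  by rewrite ev; exists ((1 * x)%g, (1 * y)%g), 1%g => //; case: (fin_subgroup N).
have := xgetPex (1%g, 1%g) ex; rewrite -/(lift_edge e) {1}ev.
by case=> n Nn /= <-; exists n.
Qed.

Lemma proj_subl n x : (N : set Gam) n -> Defs.proj N (n * x)%g = Defs.proj N x.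
Proof.
move=> Nn; apply/proj_eqP; rewrite invgM -mulgA.
have [_ _ NV] := fin_subgroup N.
by have := fin_isnormal (x^-1)%g (NV _ Nn); rewrite invgK -mulgA.
Qed.

Lemma lift_edge_edges e : edges S (lift_edge e).
Proof.
have := valP e; rewrite in_fset_set ?inE; last exact: finite_edge_orbits.
case=> -[x y] [s sS /= ey] ev.
have [n _ ->] := lift_edgeP (esym ev); exists s => //=.
by rewrite ey mulgA.
Qed.

Definition total_energy g : R :=
  \sum_(e : quot_edge S N) exchange_energy g (quot_origin e) (quot_terminus e).

Lemma total_energy_ge0 g : 0 <= total_energy g.
Proof. by apply: sumr_ge0 => e _; exact: exchange_energy_ge0. Qed.

Local Notation at_ q z := (Defs.proj N (lift_quot q * z)%g).

Lemma edge_energy g z s : s \in S ->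
  \sum_(q : V) exchange_energy g (at_ q z) (at_ q (z * s)%g) <= total_energy g.
Proof.
move=> sS; pose phi (q : V) : quot_edge S N :=
  FSetSub (edge_orbit_quot (lift_quot q * z)%g sS).
have ends q : quot_origin (phi q) = at_ q z /\
    quot_terminus (phi q) = at_ q (z * s)%g.
  have [n Nn E] := @lift_edgeP (phi q) _ _ erefl.
  by rewrite /quot_origin /quot_terminus E /= !(proj_subl _ Nn) mulgA.
have inj : injective phi.
  move=> q q' /(congr1 (@quot_origin _ _ _)).
  by rewrite !(ends _).1 => /translate_inj.
have := @sum_injective_le _ _ phi
  (fun e => exchange_energy g (quot_origin e) (quot_terminus e)) inj.
have nn b : 0 <= exchange_energy g (@quot_origin _ S N b) (quot_terminus b).
  exact: exchange_energy_ge0.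
move=> /(_ nn); apply: le_trans; apply: ler_sum => q _.
by rewrite (ends q).1 (ends q).2.
Qed.

(** Exchanging along a path of length [n], at all translates of its end points:
    each of its edges is met once by every translate, and the triangle
    inequality for the square roots costs the factor [4 n ^+ 2]. *)
Lemma path_energy g n z z' : walk (cayley_adj S) n z z' ->
  \sum_(q : V) exchange_energy g (at_ q z) (at_ q z') <=
  4 * n%:R ^+ 2 * total_energy g.
Proof.
have E0 := total_energy_ge0 g.
elim: n z => [|n IH] z /=.
  move->; rewrite big1 ?expr0n ?mulr0 ?mul0r // => q _.
  by rewrite /exchange_energy big1 // => eta _; rewrite fswapxx subrr expr0n.
case=> _ [s sS /= ->] w; have hs := edge_energy g z sS.
case: n IH w => [|n] IH w.
  by move: w => /= <-; apply: (le_trans hs); rewrite expr1n; lra.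
have k0 : 0 < n.+1%:R :> R by rewrite ltr0n.
apply: (@le_trans _ _ (\sum_(q : V) (n.+1%:R + 1) *
   (4 * exchange_energy g (at_ q z) (at_ q (z * s)%g) +
    exchange_energy g (at_ q (z * s)%g) (at_ q z') / n.+1%:R))).
  by apply: ler_sum => q _; exact: exchange_triangle.
rewrite -mulr_sumr big_split /= -mulr_sumr -mulr_suml.
apply: (@le_trans _ _ ((n.+1%:R + 1) * (4 * total_energy g +
   (4 * n.+1%:R ^+ 2 * total_energy g) / n.+1%:R))).
  rewrite ler_pM2l ?addr_gt0 //; apply: lerD; first by rewrite ler_pM2l.
  by rewrite ler_pM2r ?invr_gt0 //; exact: IH.
rewrite -[n.+2%:R]natr1 le_eqVlt; apply/orP; left; apply/eqP.
by move: k0; move: (n.+1%:R) => k k0; field; rewrite gt_eqF.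
Qed.

Variable c : Gam * Gam -> config Gam -> R.
Local Notation rate e eta := (c (lift_edge e) (Defs.periodic eta)).

Lemma exclusion_gen_linear (F : X -> R) (eta : X) :
  exclusion_gen S c F eta =
  \sum_(xi : X) F xi * exclusion_gen S c (fun z : X => (z == xi)%:R) eta.
Proof.
rewrite /exclusion_gen; under [RHS]eq_bigr do rewrite mulr_sumr.
rewrite exchange_big /=; apply: eq_bigr => e _.
have pick (zeta : X) : \sum_(xi : X) F xi * (zeta == xi)%:R = F zeta.
  rewrite (bigD1 zeta) //= eqxx mulr1 big1 ?addr0 // => xi.
  by rewrite eq_sym => /negPf ->; rewrite mulr0.
have -> : F (qswap (quot_origin e) (quot_terminus e) eta) - F eta =
    \sum_(xi : X) F xi *
      ((qswap (quot_origin e) (quot_terminus e) eta == xi)%:R - (eta == xi)%:R).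
  by under eq_bigr do rewrite mulrBr; rewrite sumrB !pick.
by rewrite mulr_sumr; apply: eq_bigr => xi _; ring.
Qed.

Lemma exclusion_gen_bounded : exists2 M : R, 0 <= M & forall (F : X -> R) B,
  (forall eta, `|F eta| <= B) ->
  forall eta : X, `|exclusion_gen S c F eta| <= M * B.
Proof.
exists (\sum_(eta : X) \sum_(e : quot_edge S N) 2 * `|rate e eta|).
  by apply: sumr_ge0 => eta _; apply: sumr_ge0 => e _; exact: mulr_ge0.
move=> F B FB eta; have B0 : 0 <= B := le_trans (normr_ge0 _) (FB eta).
rewrite /exclusion_gen; apply: le_trans (ler_norm_sum _ _ _) _.
rewrite (bigD1 eta) //= mulrDl; apply: ler_wpDr.
  apply: mulr_ge0 => //; apply: sumr_ge0 => x _; apply: sumr_ge0 => e _.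
  exact: mulr_ge0.
rewrite mulr_suml; apply: ler_sum => e _; rewrite normrM mulrAC mulrC.
rewrite ler_wpM2r //; apply: le_trans (ler_normB _ _) _.
by have := FB eta; have := FB (qswap (quot_origin e) (quot_terminus e) eta); lra.
Qed.

(** Summation by parts: reindexing by the exchange, under which the rate is
    invariant, turns each term into minus half a square. *)
Lemma dirichlet_form c0 g :
  (forall e (eta : X),
     rate e (qswap (quot_origin e) (quot_terminus e) eta) = rate e eta) ->
  (forall e (eta : X), c0 <= rate e eta) ->
  \sum_(eta : X) g eta * exclusion_gen S c g eta <= - (c0 / 2) * total_energy g.
Proof.
move=> csym clow; rewrite /exclusion_gen.
under eq_bigr do rewrite mulr_sumr.
rewrite exchange_big /= /total_energy mulr_sumr; apply: ler_sum => e _.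
set o' := quot_origin e; set t' := quot_terminus e.
set A := leLHS.
have A2 : A = \sum_(eta : X) g (fswap o' t' eta) *
    (rate e eta * (g eta - g (fswap o' t' eta))).
  rewrite /A -(sum_fswap o' t' (fun eta : X =>
    g eta * (rate e eta * (g (qswap o' t' eta) - g eta)))).
  apply: eq_bigr => eta _.
  have T1 : qswap o' t' (fswap o' t' eta) = eta := fswapK o' t' eta.
  have T2 : rate e (fswap o' t' eta) = rate e eta := csym e eta.
  by rewrite T1 T2.
have : A + A <= - c0 * exchange_energy g o' t'.
  rewrite {2}A2 /A -big_split /exchange_energy /= mulr_sumr; apply: ler_sum => eta _.
  rewrite -[qswap _ _ _]/(fswap o' t' eta).
  have := ler_wpM2r (sqr_ge0 (g (fswap o' t' eta) - g eta)) (clow e eta).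
  lra.
by lra.
Qed.

End Dirichlet.

Section RateSymmetry.
Variables (R : realType) (Gam : groupType) (S : {fset Gam}).
Hypotheses (S_symmetric : symmetric_set S) (S_generates : generated_by S).
Local Notation gd := (gdist (cayley_adj S)).

Lemma gdist_le n x y : walk (cayley_adj S) n x y -> (gd x y <= n)%N.
Proof.
move=> w; rewrite leqNgt; apply/negP => lt.
have ex : exists k, [set k | walk (cayley_adj S) k x y /\
    forall j, walk (cayley_adj S) j x y -> (k <= j)%N] k.
  pose p n := `[< walk (cayley_adj S) n x y >].
  have exp : exists k, p k by exists n; exact/asboolP.
  case: (ex_minnP exp) => k /asboolP wk kmin; exists k; split=> // j wj.
  by apply: kmin; exact/asboolP.
have [_ /(_ _ w)] := xgetPex 0%N ex.
by rewrite leqNgt lt.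
Qed.

(** Exchanging the two end points of an edge in the quotient exchanges them
    at all their lifts; the rate only sees those close to the edge, and these
    are the end points themselves as soon as [N] avoids a fixed ball. *)
Lemma rate_exchange (c : Gam * Gam -> config Gam -> R) : jump_rate S c ->
  exists l : seq Gam, forall N : finite_index_normal Gam,
  (forall g, g \in l -> (N : set Gam) g -> g = 1%g) ->
  forall (e : quot_edge S N) (eta : qconfig N),
  c (lift_edge e) (Defs.periodic (qswap (quot_origin e) (quot_terminus e) eta)) =
  c (lift_edge e) (Defs.periodic eta).
Proof.
case=> -[[r r0 cloc] _] _ cswap _.
have [l _ lP] := cball_finite S_symmetric S_generates 1%g (r + 1).
exists l => N Nl e eta; have eS := lift_edge_edges e.
rewrite [RHS](cswap _ _ eS); apply: cloc => // z zb.
set x := (lift_edge e).1; set y := (lift_edge e).2.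
have near1 u : (exists2 n, walk (cayley_adj S) n u z & n%:R <= r + 1) ->
    (Defs.proj N z == Defs.proj N u) = (z == u).
  case=> n w nr; apply/eqP/eqP => [/esym/proj_eqP Nu|-> //].
  suff : (u^-1 * z = 1)%g by move=> /mulg1_eq; rewrite invgK.
  apply: Nl => //; apply: lP; rewrite /cball /=; apply: le_trans nr.
  by rewrite ler_nat; apply: gdist_le; have := walk_mulg (u^-1)%g w; rewrite mulVg.
have xy : walk (cayley_adj S) 1 x y by exists y => //; rewrite /cayley_adj -surjective_pairing.
have hz : (Defs.proj N z == Defs.proj N x) = (z == x) /\ (Defs.proj N z == Defs.proj N y) = (z == y).
  have w u := gdist_walk S_symmetric S_generates u z.
  case: zb; rewrite /cball /= -/x -/y => zr; split; apply: near1.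
  - by exists (gd x z) => //; lra.
  - exists (1 + gd x z)%N; last by rewrite natrD; lra.
    exact: walk_cat (walk_rev S_symmetric xy) (w x).
  - exists (1 + gd y z)%N; last by rewrite natrD; lra.
    exact: walk_cat xy (w y).
  - by exists (gd y z) => //; lra.
by rewrite /Defs.periodic /qswap ffunE /swap /quot_origin /quot_terminus -/x -/y !hz.1 !hz.2.
Qed.

End RateSymmetry.

(** * The exponential moment of an additive functional *)

Section SemigroupExpansion.
Variable R : realType.

Lemma expR_first_order (x : R) : `|x| <= 2^-1 ->
  `|expR x - 1 - x| <= 2 * x ^+ 2.
Proof.
move=> /ler_normlP[x1 x2]; have e1 := expR_ge1Dx x; have e2 := expR_ge1Dx (- x).
have e0 := expR_gt0 x; have := expRxMexpNx_1 x => ee.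
rewrite ger0_norm; last by lra.
suff : expR x <= 1 + x + 2 * x ^+ 2 by lra.
have x2p : 0 <= x ^+ 2 by exact: sqr_ge0.
have h1 : 1 <= (1 + x + 2 * x ^+ 2) * (1 - x).
  have -> : (1 + x + 2 * x ^+ 2) * (1 - x) = 1 + x ^+ 2 * (1 - 2 * x) by ring.
  by rewrite lerDl mulr_ge0 //; lra.
have h2 : expR x * (1 - x) <= 1 by rewrite -[leRHS]ee ler_wpM2l // ltW.
have h3 : expR x * (1 - x) <= (1 + x + 2 * x ^+ 2) * (1 - x) by lra.
by rewrite -(@ler_pM2r _ (1 - x)) //; lra.
Qed.

Lemma semigroup_expansion (X : Type) (L : (X -> R) -> (X -> R)) M B F x h :
  0 <= h <= 1 -> 0 <= M -> 0 <= B ->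
  (forall F B, (forall x, `|F x| <= B) -> forall x, `|L F x| <= M * B) ->
  (forall x, `|F x| <= B) ->
  `|semigroup L h F x - (F x + h * L F x)| <= h ^+ 2 * (B * expR M).
Proof.
move=> /andP[h0 h1] M0 B0 Lbd FB; rewrite /semigroup.
set u := fun k => _.
have itb k y : `|iter k L F y| <= M ^+ k * B.
  elim: k y => [|k IH] y /=; first by rewrite expr0 mul1r.
  by rewrite exprS -mulrA; apply: Lbd.
have ub k : `|u k| <= h ^+ k * (B * exp_coeff M k).
  rewrite /u /exp_coeff /= normrM.
  rewrite ger0_norm ?divr_ge0 ?exprn_ge0 // -mulrA ler_wpM2l ?exprn_ge0 //.
  have f0 : 0 <= k`!%:R^-1 :> R by rewrite invr_ge0.
  have /(ler_wpM2l f0) /le_trans := itb k x; apply.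
  by rewrite le_eqVlt; apply/orP; left; apply/eqP; ring.
have ec0 k : 0 <= B * exp_coeff M k by rewrite mulr_ge0 // exp_coeff_ge0.
have ub1 k : `|u k| <= B * exp_coeff M k.
  by apply: le_trans (ub k) _; rewrite ler_piMl // exprn_ile1.
have ub2 k : `|u k.+2| <= h ^+ 2 * (B * exp_coeff M k.+2).
  apply: le_trans (ub _) _; rewrite -addn2 addnC exprD -mulrA ler_wpM2l ?sqr_ge0 //.
  by rewrite ler_piMl // exprn_ile1.
have cvE : cvgn (series (fun k => B * exp_coeff M k)).
  have -> : series (fun k => B * exp_coeff M k) = (fun n => B * series (exp_coeff M) n).
    by apply/funext => n; rewrite /series /= mulr_sumr.
  by apply: is_cvgMr; exact: is_cvg_series_exp_coeff.
have cvu : cvgn (series u).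
  apply: normed_cvg; apply: (series_le_cvg _ _ ub1) => //=.
have expM n : series (exp_coeff M) n <= expR M.
  apply: nondecreasing_cvgn_le; last exact: is_cvg_series_exp_coeff.
  by apply: nondecreasing_series => *; exact: exp_coeff_ge0.
have part n : `|series u n.+2 - (F x + h * L F x)| <= h ^+ 2 * (B * expR M).
  have -> : series u n.+2 - (F x + h * L F x) = \sum_(0 <= k < n) u k.+2.
    rewrite /series /= big_nat_recl // big_nat_recl // /u /=.
    by rewrite expr0 expr1 fact0 invr1 !mulr1 !mul1r; ring.
  apply: le_trans (ler_norm_sum _ _ _) _.
  apply: (@le_trans _ _ (\sum_(0 <= k < n) h ^+ 2 * (B * exp_coeff M k.+2))).
    by apply: ler_sum.
  rewrite -!mulr_sumr ler_wpM2l ?sqr_ge0 // ler_wpM2l //.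
  apply: le_trans (expM n.+2).
  rewrite /series /= big_nat_recl // big_nat_recl // addrA lerDr addr_ge0 //; exact: exp_coeff_ge0.
rewrite ler_distl; apply/andP; split.
- apply: limr_ge => //; near=> n.
  have /subnK <- : (2 <= n)%N by near: n; exact: nbhs_infty_ge.
  by rewrite addn2; have := part (n - 2)%N; rewrite ler_distl => /andP[].
- apply: limr_le => //; near=> n.
  have /subnK <- : (2 <= n)%N by near: n; exact: nbhs_infty_ge.
  by rewrite addn2; have := part (n - 2)%N; rewrite ler_distl => /andP[].
Unshelve. all: by end_near.
Qed.

End SemigroupExpansion.

Section TiltedSemigroup.
Variables (R : realType) (X : finType) (L : (X -> R) -> (X -> R)) (W : X -> R).
Variables (M Wm lam : R).
Hypotheses (M0 : 0 <= M) (L_bounded : forall F B, (forall x, `|F x| <= B) ->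
  forall x, `|L F x| <= M * B).
Hypothesis L_linear : forall F x,
  L F x = \sum_(y : X) F y * L (fun z => (z == y)%:R) x.
Hypotheses (Wm0 : 0 <= Wm) (W_bounded : forall x, `|W x| <= Wm).
Hypothesis L_spectral : forall g : X -> R,
  \sum_(x : X) g x * (L g x + W x * g x) <= lam * \sum_(x : X) g x ^+ 2.

Lemma cauchy_schwarz_card (v : X -> R) :
  (\sum_(x : X) `|v x|) ^+ 2 <= #|X|%:R * \sum_(x : X) v x ^+ 2.
Proof.
have : \sum_(x : X) \sum_(y : X) 2 * (`|v x| * `|v y|) <=
       \sum_(x : X) \sum_(y : X) (v x ^+ 2 + v y ^+ 2).
  apply: ler_sum => x _; apply: ler_sum => y _.
  rewrite -(real_normK (num_real (v x))) -(real_normK (num_real (v y))).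
  by have := sqr_ge0 (`|v x| - `|v y|); rewrite !expr2; lra.
under eq_bigr do rewrite -mulr_sumr -mulr_sumr.
rewrite -mulr_sumr -mulr_suml -expr2.
under [leRHS]eq_bigr do rewrite big_split /= sumr_const.
rewrite big_split /= sumr_const sumrMnl -(mulr_natl _ #|X|).
have -> : #|X| = #|xpredT : pred X| by [].
lra.
Qed.

(** One factor exp(h L) exp(h W) of the Trotter product for exp(L + W). *)
Definition tilted h (v : X -> R) (x : X) : R :=
  \sum_(y : X) transition L h x y * (expR (h * W y) * v y).

Lemma tilted_expansion : exists2 K : R, 0 <= K &
  forall h, 0 <= h <= 1 -> h * Wm <= 2^-1 -> forall (v : X -> R) x,
  `|tilted h v x - (v x + h * (L v x + W x * v x))| <=
  h ^+ 2 * K * \sum_(y : X) `|v y|.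
Proof.
exists (2 * expR M + 2 * Wm ^+ 2 + 2 * M * Wm).
  by rewrite !addr_ge0 ?mulr_ge0 ?sqr_ge0 ?expR_ge0.
move=> h h01 hW v x; have /andP[h0 h1] := h01.
pose d (y : X) : X -> R := fun z => (z == y)%:R.
have db y z : `|d y z| <= 1 by rewrite /d; case: eqP; rewrite ?normr1 ?normr0.
have -> : v x + h * (L v x + W x * v x) =
  \sum_(y : X) (d y x + h * L (d y) x + d y x * (h * W y)) * v y.
  have sd (a : X -> R) : \sum_(y : X) d y x * a y = a x.
    rewrite (bigD1 x) //= /d eqxx mul1r big1 ?addr0 // => y yx.
    by rewrite eq_sym (negPf yx) mul0r.
  under eq_bigr do rewrite mulrDl mulrDl -!mulrA.
  rewrite !big_split /= (sd v) (sd (fun y => h * (W y * v y))) -mulr_sumr L_linear.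
  under [in RHS]eq_bigr do rewrite mulrC.
  by rewrite -/d; ring.
rewrite /tilted -sumrB mulr_sumr.
apply: le_trans (ler_norm_sum _ _ _) _; apply: ler_sum => y _.
rewrite mulrA -mulrBl normrM; apply: ler_wpM2r => //.
have := semigroup_expansion x h01 M0 ler01 L_bounded (db y).
rewrite mul1r -/(transition L h x y).
set p := transition L h x y; set A := L (d y) x.
have A1 : `|A| <= M by have := L_bounded (db y) x; rewrite mulr1.
have hWy : `|h * W y| <= h * Wm by rewrite normrM ger0_norm // ler_wpM2l.
have := expR_first_order (le_trans hWy hW).
set w := h * W y in hWy *; set e := expR w.
have w2 : w ^+ 2 <= h ^+ 2 * Wm ^+ 2.
  by rewrite -(real_normK (num_real w)) -exprMn ler_sqr ?nnegrE ?mulr_ge0.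
move=> he hp.
have -> : p * e - (d y x + h * A + d y x * w) =
  (p - (d y x + h * A)) * e + (d y x * (e - 1 - w) + h * A * (e - 1)) by ring.
have hw : `|w| <= 2^-1 by lra.
have hw2 : w ^+ 2 <= 2^-1 * `|w|.
  by rewrite -(real_normK (num_real w)) expr2 ler_wpM2r.
have e1 : `|e - 1| <= 2 * (h * Wm).
  have -> : e - 1 = (e - 1 - w) + w by ring.
  by apply: le_trans (ler_normD _ _) _; lra.
have e2 : `|e| <= 2.
  have -> : e = (e - 1) + 1 by ring.
  by apply: le_trans (ler_normD _ _) _; rewrite normr1; lra.
apply: le_trans (ler_normD _ _) _; rewrite normrM.
have t1 : `|p - (d y x + h * A)| * `|e| <= (h ^+ 2 * expR M) * 2.
  by apply: ler_pM.
have t2 : `|d y x * (e - 1 - w)| <= 2 * (h ^+ 2 * Wm ^+ 2).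
  rewrite normrM -[leRHS]mul1r; apply: ler_pM => //.
  by apply: le_trans he _; rewrite ler_wpM2l.
have t3 : `|h * A * (e - 1)| <= h * M * (2 * (h * Wm)).
  rewrite normrM; apply: ler_pM => //.
  by rewrite normrM (ger0_norm h0) ler_wpM2l.
have := ler_normD (d y x * (e - 1 - w)) (h * A * (e - 1)).
rewrite -/d -/A; move: t1 t2 t3; lra.
Qed.

(** [tilted h] is [1 + h (L + W)] up to an error of order [h^2]; expanding the
    square leaves the first order term [2 h <v, (L + W) v>], which the quadratic
    form bound controls. *)
Lemma tilted_norm : exists2 K : R, 0 <= K &
  forall h, 0 <= h <= 1 -> h * Wm <= 2^-1 -> forall (v : X -> R),
  \sum_(x : X) tilted h v x ^+ 2 <=
  (1 + (2 * h * lam + K * h ^+ 2)) * \sum_(x : X) v x ^+ 2.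
Proof.
have [K1 K10 hK1] := tilted_expansion.
pose m := M + Wm; pose K2 := 2 * K1 + (m + K1) ^+ 2.
have m0 : 0 <= m by rewrite addr_ge0.
have K20 : 0 <= K2 by rewrite addr_ge0 ?sqr_ge0 // mulr_ge0.
exists (#|X|%:R * K2 * #|X|%:R); first by rewrite !mulr_ge0.
move=> h h01 hW v; have /andP[h0 h1] := h01.
pose s := \sum_(y : X) `|v y|.
have s0 : 0 <= s by apply: sumr_ge0.
have vs x : `|v x| <= s by rewrite /s (bigD1 x) //= lerDl sumr_ge0.
pose N x := L v x + W x * v x.
have Nb x : `|N x| <= m * s.
  apply: le_trans (ler_normD _ _) _; rewrite mulrDl normrM lerD ?L_bounded //.
  exact: ler_pM.
have pt x : tilted h v x ^+ 2 <= v x ^+ 2 + 2 * h * (v x * N x) + h ^+ 2 * K2 * s ^+ 2.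
  have := hK1 h h01 hW v x; rewrite -/s -/(N x).
  set r := _ - _; have -> : tilted h v x = v x + h * N x + r by rewrite /r; ring.
  move: r => r hr.
  have a1 : v x * r <= s * (h ^+ 2 * K1 * s).
    apply: le_trans (ler_norm _) _; rewrite normrM; exact: ler_pM.
  have hh : h ^+ 2 <= h by rewrite expr2 ler_piMl.
  have a2 : `|h * N x + r| <= h * (m + K1) * s.
    apply: le_trans (ler_normD _ _) _; rewrite normrM (ger0_norm h0).
    have := ler_wpM2l h0 (Nb x).
    have : h ^+ 2 * (K1 * s) <= h * (K1 * s) by rewrite ler_wpM2r // mulr_ge0.
    lra.
  have a3 : (h * N x + r) ^+ 2 <= (h * (m + K1) * s) ^+ 2.
    by rewrite -(real_normK (num_real (h * _ + r))) ler_sqr ?nnegrE // !mulr_ge0 // addr_ge0.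
  have -> : (v x + h * N x + r) ^+ 2 =
    v x ^+ 2 + 2 * h * (v x * N x) + 2 * (v x * r) + (h * N x + r) ^+ 2 by ring.
  have E : (h * (m + K1) * s) ^+ 2 = h ^+ 2 * (m + K1) ^+ 2 * s ^+ 2 by ring.
  by rewrite E in a3; rewrite /K2; move: a1 a3; rewrite expr2; lra.
apply: (@le_trans _ _ (\sum_(x : X) (v x ^+ 2 + 2 * h * (v x * N x) + h ^+ 2 * K2 * s ^+ 2))).
  by apply: ler_sum.
rewrite !big_split /= sumr_const -!mulr_sumr -[_ *+ #|X|]mulr_natl.
have hl : 2 * h * \sum_(x : X) v x * N x <= 2 * h * (lam * \sum_(x : X) v x ^+ 2).
  by rewrite ler_wpM2l ?mulr_ge0 //; exact: L_spectral.
have : #|X|%:R * K2 * h ^+ 2 * s ^+ 2 <=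
   #|X|%:R * K2 * h ^+ 2 * (#|X|%:R * \sum_(x : X) v x ^+ 2).
  rewrite ler_wpM2l ?cauchy_schwarz_card // mulr_ge0 ?sqr_ge0 // mulr_ge0 //.
move: hl; set SN := \sum_(x : X) _ * _; set S2 := \sum_(x : X) _ ^+ 2; lra.
Qed.

Lemma tilted_iter : exists2 K : R, 0 <= K &
  forall h k, 0 <= h <= 1 -> h * Wm <= 2^-1 ->
  \sum_(x : X) `|iter k (tilted h) (fun=> 1) x| <=
  #|X|%:R * expR (k%:R * h * lam + K * (k%:R * h) * h).
Proof.
have [K K0 hK] := tilted_norm; exists (K / 2); first by rewrite mulr_ge0.
move=> h k h01 hW; set y := (_ + _).
have sq : \sum_(x : X) iter k (tilted h) (fun=> 1) x ^+ 2 <=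
    expR (k%:R * (2 * h * lam + K * h ^+ 2)) * #|X|%:R.
  elim: k {y} => [|k IH] /=.
    rewrite mul0r expR0 mul1r; under eq_bigr do rewrite expr1n.
    by rewrite sumr_const.
  apply: le_trans (hK _ h01 hW _) _.
  set z := 2 * h * lam + _; have -> : k.+1%:R * z = z + k%:R * z by rewrite -natr1; ring.
  rewrite expRD.
  apply: (@le_trans _ _ (expR z * \sum_(x : X) iter k (tilted h) (fun=> 1) x ^+ 2)).
    rewrite ler_wpM2r ?expR_ge1Dx // sumr_ge0 // => x _; exact: sqr_ge0.
  by rewrite -mulrA ler_wpM2l // expR_ge0.
rewrite -ler_sqr ?nnegrE ?sumr_ge0 ?mulr_ge0 ?expR_ge0 //.
apply: le_trans (cauchy_schwarz_card _) _.
rewrite exprMn -expRM_natl expr2 -mulrA ler_wpM2l // mulrC.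
apply: le_trans sq _; rewrite ler_wpM2r // ler_expR /y.
by rewrite le_eqVlt; apply/orP; left; apply/eqP; field.
Qed.

End TiltedSemigroup.

Section RiemannSums.
Variable R : realType.

Fixpoint riemann_sum (X : Type) (phi : X -> R) (h s : R) (k : nat) (w : R -> X) :
    R :=
  if k is j.+1 then h * phi (w (s + h)) + riemann_sum phi h (s + h) j w else 0.

Lemma riemann_sumE (X : Type) (phi : X -> R) h s k (w : R -> X) :
  riemann_sum phi h s k w = \sum_(j < k) h * phi (w (s + j.+1%:R * h)).
Proof.
elim: k s => [|k IH] s /=; first by rewrite big_ord0.
rewrite big_ord_recl mul1r IH; congr (_ + _); apply: eq_bigr => j _.
by congr (h * phi (w _)); rewrite lift0 -[j.+2%:R]natr1; ring.
Qed.

Variables (psi : R -> R) (C T : R).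
Hypotheses (T0 : 0 < T) (psiC : forall s, `|psi s| <= C).
Hypothesis psi_right : forall s, 0 <= s < T ->
  \forall u \near s^'+, psi u = psi s.

Let h (k : nat) : R := T / k.+1%:R.
Let cell (k j : nat) : set R := `[j%:R * h k, j.+1%:R * h k[.
Let step (k : nat) (s : R) : R :=
  \sum_(j < k.+1) psi (j.+1%:R * h k) * \1_(cell k j) s.

Let h_gt0 k : 0 < h k. Proof. by rewrite divr_gt0. Qed.

Let step_value k s : 0 <= s < T ->
  exists2 u, s < u <= s + h k & step k s = psi u.
Proof.
move=> /andP[s0 sT]; pose j := Num.truncn (s / h k).
have /andP[j1 j2] : j%:R <= s / h k < j.+1%:R.
  by apply: truncn_itv; rewrite divr_ge0 // ltW.
rewrite ler_pdivlMr // in j1; rewrite ltr_pdivrMr // in j2.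
have jk : (j < k.+1)%N.
  rewrite -(ltr_nat R) -(ltr_pM2r (h_gt0 k)) (le_lt_trans j1) //.
  by rewrite /h mulrC divfK // pnatr_eq0.
exists (j.+1%:R * h k).
  by rewrite j2 /= -natr1 mulrDl mul1r lerD2r.
rewrite /step (bigD1 (Ordinal jk)) //= indicE mem_set ?mulr1; last first.
  by rewrite /cell /= in_itv /= j1 j2.
rewrite big1 ?addr0 // => i /eqP ij; rewrite indicE memNset ?mulr0 //.
rewrite /cell /= in_itv /= => /andP[i1 i2]; apply: ij; apply/val_inj => /=.
have : (i < j.+1)%N by rewrite -(ltr_nat R) -(ltr_pM2r (h_gt0 k)) (le_lt_trans i1).
have : (j < i.+1)%N by rewrite -(ltr_nat R) -(ltr_pM2r (h_gt0 k)) (le_lt_trans j1).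
by rewrite !ltnS => a b; apply/eqP; rewrite eqn_leq a b.
Qed.

Let step_measurable k (D : set R) : measurable D -> measurable_fun D (step k).
Proof.
move=> mD; apply: measurable_sum => j; apply: measurable_funM.
  exact: measurable_cst.
apply: measurable_indic; exact: measurable_itv.
Qed.

Let step_integral k : (\int[lebesgue_measure]_(s in `[0%R, T[) (step k s)%:E =
  (\sum_(j < k.+1) h k * psi (j.+1%:R * h k))%:E)%E.
Proof.
pose f (j : 'I_k.+1) (s : R) : \bar R := (psi (j.+1%:R * h k) *
    \1_(cell k j) s)%:E.
have int1 (j : 'I_k.+1) : (@lebesgue_measure R).-integrable `[0%R, T[
    (EFin \o \1_(cell k j)).
  apply: (@integrableS _ _ _ _ setT) => //.
  exact: integrable_indic_itv.
have -> : (\int[lebesgue_measure]_(s in `[0%R, T[) (step k s)%:E =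
   \int[lebesgue_measure]_(s in `[0%R, T[) (\sum_(j < k.+1) f j s))%E.
  by apply: eq_integral => s _; rewrite /step sumEFin.
rewrite integral_sum //; last first.
  move=> j; rewrite /f.
  have -> : (fun s => (psi (j.+1%:R * h k) * \1_(cell k j) s)%:E) =
    (fun s => (psi (j.+1%:R * h k))%:E * (EFin \o \1_(cell k j)) s)%E.
    by apply/funext => s; rewrite EFinM.
  exact: integrableZl.
rewrite -sumEFin; apply: eq_bigr => j _; rewrite /f.
under eq_integral do rewrite EFinM.
rewrite integralZl //; last exact: int1.
rewrite [in RHS]mulrC EFinM; congr (_ * _)%E.
transitivity (lebesgue_measure (cell k j `&` `[0, T[)).
  by apply: integral_indic; exact: measurable_itv.
rewrite setIidl; last first.
  move=> s; rewrite /cell /= !in_itv /= => /andP[s1 s2]; apply/andP; split.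
    by apply: le_trans s1; rewrite mulr_ge0 // ltW.
  apply: (lt_le_trans s2); rewrite /h mulrA ler_pdivrMr // mulrC ler_pM2l //.
  by rewrite ler_nat.
rewrite /cell lebesgue_measure_itv /= lte_fin ltr_pM2r // ltr_nat ltnSn.
by rewrite -EFinB -mulrBl -natr1 addrAC subrr add0r mul1r.
Qed.

(** Right-continuity suffices: the step functions that read [psi] at the right
    end of each cell converge to [psi] everywhere on [0, T[. *)
Lemma riemann_sum_cvg :
  riemann_sum psi (h k) 0 k.+1 id @[k --> \oo] -->
  \int[lebesgue_measure]_(s in `[0%R, T]) psi s.
Proof.
have C0 : 0 <= C by apply: le_trans (psiC 0).
have cvs s : `[0, T[%classic s -> step ^~ s @ \oo --> psi s.
  rewrite /= in_itv /= => sT; apply: cvg_near_cst.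
  have [d /= d0 dP] := psi_right sT.
  have : \forall k \near \oo, T / d < k%:R by exact: nbhs_infty_gtr.
  apply: filterS => k kd.
  have [u /andP[u1 u2] ->] := step_value k sT; apply: dP => //=.
  rewrite distrC ger0_norm ?subr_ge0 ?(ltW u1) // ltrBlDl.
  apply: (le_lt_trans u2); rewrite ltrD2l /h ltr_pdivrMr // -ltr_pdivrMl // mulrC.
  by apply: (lt_trans kd); rewrite ltr_nat.
have mpsi : measurable_fun `[0, T[%classic psi.
  by apply: measurable_fun_cvg cvs => k; exact: step_measurable.
have := @dominated_convergence _ _ R lebesgue_measure `[0%R, T[%classic
  (measurable_itv _) (fun k => EFin \o step k) (EFin \o psi) (cst C%:E).
case.
- by move=> k; apply/measurable_EFinP; exact: step_measurable.
- exact/measurable_EFinP.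
- apply: aeW => s sT; apply: cvg_EFin; first exact: nearW.
  exact: cvs.
- apply: measurable_bounded_integrable => //; last exact: bounded_cst.
  by rewrite /= lebesgue_measure_itv /= lte_fin T0 sube0 ltry.
- apply: aeW => s k; rewrite /= in_itv /= lee_fin => sT.
  by have [u _ ->] := step_value k sT.
move=> ipsi _.
rewrite -Rintegral_itv_bndo_bndc //.
have fin : (\int[lebesgue_measure]_(s in `[0%R, T[) (EFin \o psi) s)%E \is a fin_num.
  by apply: integrable_fin_num.
rewrite -(fineK fin) => /fine_cvg; apply: cvg_trans.
apply: near_eq_cvg; apply: nearW => k.
transitivity (riemann_sum psi (h k) 0 k.+1 id) => //.
rewrite riemann_sumE [LHS]/= step_integral; apply: eq_bigr => j _.
by rewrite add0r.
Qed.

End RiemannSums.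

Section FeynmanKac.
Variable R : realType.

Lemma prob_decomposition d (Om : measurableType d) (P : probability Om R)
    (X : finType) (xi : Om -> X) (E : set Om) :
  measurable E -> (forall x, measurable [set w | xi w = x]) ->
  fine (P E) = \sum_(x : X) fine (P (E `&` [set w | xi w = x])).
Proof.
move=> mE mxi.
suff key (r : seq X) : uniq r -> measurable [set w | xi w \in r] /\
    fine (P (E `&` [set w | xi w \in r])) =
    \sum_(x <- r) fine (P (E `&` [set w | xi w = x])).
  have [_] := key (enum X) (enum_uniq X); rewrite big_enum /= => <-.
  congr (fine (P _)); apply/seteqP; split=> w /=; last by case.
  by move=> Ew; rewrite mem_enum.
elim: r => [_|x r IH] /=.
  have -> : [set w | xi w \in [::]] = set0 by apply/seteqP; split.
  by rewrite setI0 measure0 big_nil.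
case/andP => xr /IH[mr er]; rewrite big_cons -er.
have -> : [set w | xi w \in x :: r] = [set w | xi w = x] `|` [set w | xi w \in r].
  apply/seteqP; split => w /=; rewrite inE; first by case/orP => [/eqP|]; [left|right].
  by case=> [->|->]; rewrite ?eqxx ?orbT.
split; first exact: measurableU.
rewrite setIUr measureU; [|exact: measurableI..|].
  by rewrite fineD // fin_num_measure //; exact: measurableI.
apply/seteqP; split => // w /= [[_ wx] [_]]; by rewrite wx (negPf xr).
Qed.

Variables (T : R) (V : finType).
Hypothesis T0 : 0 < T.
Local Notation X := {ffun V -> bool}.
Local Notation Paths := (pathSpace T X).

Lemma measurable_at (s : R) (B : set X) : measurable [set w : Paths | B (w s)].
Proof.
have -> : [set w : Paths | B (w s)] = \bigcup_(x in B) [set w : Paths | w s = x].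
  by apply/seteqP; split => [w Bw|w [x Bx] /= ->] //; exists (w s).
apply: fin_bigcup_measurable; first exact: finite_finset.
by move=> x _; apply: sub_sigma_algebra; exists s, x.
Qed.

Lemma measurable_riemann_sum (phi : X -> R) h s k :
  measurable_fun setT (fun w : Paths => riemann_sum phi h s k w).
Proof.
elim: k s => [|k IH] s /=; first exact: measurable_cst.
apply: measurable_funD; last exact: IH.
move=> _ B mB; rewrite setTI.
exact: (measurable_at _ [set x | B (h * phi x)]).
Qed.

Definition cylinder (x0 : X) (l : seq (R * X)) : set Paths :=
  [set w | w 0 = x0 /\ forall p, p \in l -> w p.1 = p.2].

Lemma cylinder_rcons x0 l u y :
  cylinder x0 (rcons l (u, y)) = cylinder x0 l `&` [set w | w u = y].
Proof.
apply/seteqP; split => w /=; rewrite /cylinder /=.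
  case=> w0 wl; split; last by apply: (wl (u, y)); rewrite mem_rcons mem_head.
  by split=> // p pl; apply: wl; rewrite mem_rcons inE pl orbT.
case=> [[w0 wl] wu]; split=> // p; rewrite mem_rcons inE => /orP[/eqP -> //|].
exact: wl.
Qed.

Lemma measurable_cylinder x0 l : measurable (cylinder x0 l).
Proof.
elim/last_ind: l => [|l [u y] IH].
  have -> : cylinder x0 [::] = [set w | [set x0] (w 0)].
    by apply/seteqP; split => w //= [].
  exact: measurable_at.
rewrite cylinder_rcons; apply: measurableI => //.
exact: (measurable_at u [set y]).
Qed.

Lemma transitions_rcons (L : (X -> R) -> (X -> R)) s0 x0 l u y :
  transitions L s0 x0 (rcons l (u, y)) =
  transitions L s0 x0 l *
  transition L (u - last s0 (map fst l)) (last x0 (map snd l)) y.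
Proof.
elim: l s0 x0 => [|[u' y'] l IH] s0 x0 /=; first by rewrite mulr1 mul1r.
by rewrite IH mulrA.
Qed.

Variables (L : (X -> R) -> (X -> R)) (mu : set X -> \bar R).
Variables (P : probability Paths R) (U : X -> R) (a : R).
Hypothesis P_law : markov_law L mu P.
Hypothesis a0 : 0 <= a.

(** The Markov property, used from the end of the path backwards: conditioning
    on the position after one more step of length [h] multiplies the bound by
    one factor of the tilted semigroup. *)
Lemma exponential_chebyshev h k s x x0 l c : 0 <= h ->
  path <=%R 0 (map fst l) -> all (<= T) (map fst l) ->
  last 0 (map fst l) = s -> last x0 (map snd l) = x -> s + k%:R * h <= T ->
  fine (P (cylinder x0 l `&` [set w : Paths | c <= riemann_sum U h s k w])) <=
  expR (- (a * c)) *
  (fine (P (cylinder x0 l)) *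
   iter k (tilted L (fun y => a * U y) h) (fun=> 1) x).
Proof.
move=> h0; elim: k s x l c => [|k IH] s x l c sl lT ls lx skT /=.
  have := measure_ge0 P (cylinder x0 l) => P0.
  set E0 := (X in _ `&` X).
  have [c0|c0] := lerP c 0.
    have -> : E0 = setT by apply/seteqP; split.
    rewrite setIT mulr1 ler_peMl ?fine_ge0 // -expR0 ler_expR oppr_ge0.
    by rewrite mulr_ge0_le0.
  have -> : E0 = set0.
    by apply/seteqP; split => // w; rewrite /E0 /= leNgt c0.
  by rewrite setI0 measure0 /= !mulr_ge0 ?expR_ge0 ?fine_ge0.
set E := _ `&` _.
have mE : measurable E.
  apply: measurableI; first exact: measurable_cylinder.
  have := @measurable_riemann_sum U h s k.+1 measurableT `[c, +oo[%classic (measurable_itv _).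
  rewrite setTI; congr (measurable _); apply/seteqP.
  by split => w /=; rewrite in_itv /= andbT.
rewrite (@prob_decomposition _ _ P _ (fun w : Paths => w (s + h)) E mE); last first.
  by move=> y; exact: (measurable_at _ [set y]).
rewrite {1}/tilted mulr_sumr mulr_sumr; apply: ler_sum => y _.
have -> : E `&` [set w | w (s + h) = y] =
  cylinder x0 (rcons l (s + h, y)) `&`
  [set w : Paths | c - h * U y <= riemann_sum U h (s + h) k w].
  rewrite cylinder_rcons /E; apply/seteqP; split => w /=.
    by case=> [[wl cw] wy]; split => //; rewrite lerBlDl -wy.
  by case=> [[wl wy]]; rewrite lerBlDl -wy => cw.
have sh : s + h <= T.
  by apply: le_trans skT; rewrite lerD2l -natr1 mulrDl mul1r lerDr mulr_ge0.
have := IH (s + h) y (rcons l (s + h, y)) (c - h * U y).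
have sl' : path <=%R 0 (map fst (rcons l (s + h, y))).
  by rewrite map_rcons rcons_path sl ls /= lerDl.
have lT' : all (<= T) (map fst (rcons l (s + h, y))).
  by rewrite map_rcons all_rcons /= sh.
rewrite !map_rcons !last_rcons -!map_rcons => /(_ sl' lT' erefl erefl).
have -> : s + h + k%:R * h <= T by move: skT; rewrite -natr1; lra.
move=> /(_ erefl) /le_trans; apply.
rewrite le_eqVlt; apply/orP; left; apply/eqP.
have -> : fine (P (cylinder x0 (rcons l (s + h, y)))) =
    fine (P (cylinder x0 l)) * transition L h x y.
  rewrite [in LHS]/cylinder (P_law _ sl' lT') /cylinder (P_law _ sl lT).
  rewrite transitions_rcons ls lx EFinM muleA fineM //.
    by rewrite /= addrAC subrr add0r.
  by rewrite -(P_law _ sl lT) fin_num_measure //; exact: measurable_cylinder.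
have -> : - (a * (c - h * U y)) = - (a * c) + h * (a * U y) by ring.
rewrite expRD; ring.
Qed.

Lemma riemann_sum_tail h k c : 0 <= h -> k%:R * h <= T ->
  fine (P [set w : Paths | c <= riemann_sum U h 0 k w]) <=
  expR (- (a * c)) *
  \sum_(x : X) `|iter k (tilted L (fun y => a * U y) h) (fun=> 1) x|.
Proof.
move=> h0 khT; set E := [set w | _].
have mE : measurable E.
  have := @measurable_riemann_sum U h 0 k measurableT `[c, +oo[%classic (measurable_itv _).
  rewrite setTI; congr (measurable _); apply/seteqP.
  by split => w /=; rewrite in_itv /= andbT.
rewrite (@prob_decomposition _ _ P _ (fun w : Paths => w 0) E mE); last first.
  by move=> y; exact: (measurable_at _ [set y]).
rewrite mulr_sumr; apply: ler_sum => x _.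
have Ec : [set w : Paths | w 0 = x] = cylinder x [::].
  by apply/seteqP; split => w /= [].
have mC := measurable_cylinder x [::].
rewrite setIC Ec.
have := @exponential_chebyshev h k 0 x x [::] c h0 erefl erefl erefl erefl.
rewrite add0r => /(_ khT) /le_trans; apply.
rewrite ler_wpM2l ?expR_ge0 //; apply: le_trans (ler_norm _) _.
rewrite normrM ler_piMl // ger0_norm ?fine_ge0 //.
by rewrite -lee_fin fineK ?fin_num_measure // probability_le1.
Qed.

Variables (M Um lam : R).
Hypotheses (M0 : 0 <= M) (L_bounded : forall F B, (forall x, `|F x| <= B) ->
  forall x, `|L F x| <= M * B).
Hypothesis L_linear : forall F x,
  L F x = \sum_(y : X) F y * L (fun z => (z == y)%:R) x.
Hypotheses (Um0 : 0 <= Um) (U_bounded : forall x, `|U x| <= Um).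
Hypothesis L_spectral : forall g : X -> R,
  \sum_(x : X) g x * (L g x + a * U x * g x) <= lam * \sum_(x : X) g x ^+ 2.

(** The quadratic form bound [lam] controls the exponential moment of each
    Riemann sum; halving the level absorbs the passage to the integral. *)
Lemma feynman_kac (c : R) : 0 < c ->
  (P [set w : Paths | (c <= \int[lebesgue_measure]_(s in `[0, T]) U (w s))%R]
   <= (#|{: X}|%:R * expR (lam * T + 1 - a * (c / 2)))%:E)%E.
Proof.
move=> c0; pose h k : R := T / k.+1%:R.
have kh k : k.+1%:R * h k = T by rewrite /h mulrC divfK // pnatr_eq0.
have cv (w : Paths) : riemann_sum U (h k) 0 k.+1 w @[k --> \oo] -->
   \int[lebesgue_measure]_(s in `[0%R, T]) U (w s).
  have -> : (fun k => riemann_sum U (h k) 0 k.+1 w) =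
      (fun k => riemann_sum (fun s => U (w s)) (h k) 0 k.+1 id).
    by apply/funext => k; rewrite !riemann_sumE.
  apply: (riemann_sum_cvg T0 (fun s => U_bounded (w s))) => s sT.
  by have := cadlag_right w sT; apply: filterS => u ->.
have mI : measurable_fun setT (fun w : Paths => \int[lebesgue_measure]_(s in `[0%R, T]) U (w s)).
  apply: (@measurable_fun_cvg _ _ _ _ (fun k (w : Paths) => riemann_sum U (h k) 0 k.+1 w)).
    by move=> k; exact: measurable_riemann_sum.
  by move=> w _; exact: cv.
have mE : measurable [set w : Paths | c <= \int[lebesgue_measure]_(s in `[0%R, T]) U (w s)].
  have := mI measurableT `[c, +oo[%classic (measurable_itv _).
  rewrite setTI; congr (measurable _); apply/seteqP.
  by split => w /=; rewrite in_itv /= andbT.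
set E := [set w | _] in mE *.
pose Ek k := [set w : Paths | c / 2 <= riemann_sum U (h k) 0 k.+1 w].
have mEk k : measurable (Ek k).
  have := @measurable_riemann_sum U (h k) 0 k.+1 measurableT `[c / 2, +oo[%classic (measurable_itv _).
  rewrite setTI; congr (measurable _); apply/seteqP.
  by split => w /=; rewrite in_itv /= andbT.
set bound := _ * expR _.
have aU y : `|a * U y| <= a * Um by rewrite normrM ger0_norm // ler_wpM2l.
have aUm0 : 0 <= a * Um by rewrite mulr_ge0.
have [K K0 hK] := tilted_iter M0 L_bounded L_linear aUm0 aU L_spectral.
have [k0 k0P] : exists k0, forall k, (k0 <= k)%N ->
    (P (Ek k) <= bound%:E)%E.
  have h_small e : 0 < e -> \forall k \near \oo, h k <= e.
    move=> e0; have : \forall k \near \oo, T / e < k%:R by exact: nbhs_infty_gtr.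
    apply: filterS => k kd; rewrite /h ler_pdivrMr // -ler_pdivrMl // mulrC ltW //.
    by apply: (lt_trans kd); rewrite ltr_nat.
  have : \forall k \near \oo, (P (Ek k) <= bound%:E)%E.
    near=> k.
    have hk0 : 0 <= h k by rewrite divr_ge0 // ltW.
    have hk1 : h k <= 1 by near: k; exact: h_small.
    have hkU : h k <= 2^-1 / (a * Um + 1).
      by near: k; apply: h_small; rewrite divr_gt0 // ltr_wpDl.
    have hkK : h k <= 1 / (K * T + 1).
      by near: k; apply: h_small; rewrite divr_gt0 // ltr_wpDl // mulr_ge0 // ltW.
    have h01 : 0 <= h k <= 1 by rewrite hk0 hk1.
    have hU2 : h k * (a * Um) <= 2^-1.
      rewrite ler_pdivlMr ?ltr_wpDl // in hkU; apply: le_trans hkU.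
      by rewrite ler_wpM2l // lerDl.
    have hK1 : h k * (K * T) <= 1.
      rewrite ler_pdivlMr ?ltr_wpDl // in hkK; last by rewrite mulr_ge0 // ltW.
      by apply: le_trans hkK; rewrite ler_wpM2l // lerDl.
    rewrite -(fineK (fin_num_measure P _ (mEk k))) lee_fin.
    apply: le_trans (@riemann_sum_tail (h k) k.+1 (c / 2) hk0 _) _; first by rewrite kh.
    have := hK (h k) k.+1 h01 hU2; rewrite kh.
    move=> /(ler_wpM2l (expR_ge0 (- (a * (c / 2))))) /le_trans; apply.
    rewrite mulrCA /bound -expRD ler_wpM2l // ler_expR; move: hK1; lra.
  by case=> k0 _ k0P; exists k0.
(* [E] is contained in the limit inferior of the [Ek]. *)
pose Fn n := \bigcap_(k in [set k | (k0 + n <= k)%N]) Ek k.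
have mFn n : measurable (Fn n) by apply: bigcap_measurable => [|k _]; [by exists (k0 + n)%N => /=|exact: mEk].
have mF : measurable (\bigcup_n Fn n) by exact: bigcup_measurable.
have EF : E `<=` \bigcup_n Fn n.
  move=> w /= cw.
  have : \forall k \near \oo, c / 2 < riemann_sum U (h k) 0 k.+1 w.
    apply: (cvgr_gt _ (cv w)); apply: lt_le_trans cw; lra.
  case=> n _ nP; exists n => // k /= nk; rewrite /Ek /= ltW //; apply: nP => /=.
  by apply: leq_trans nk; rewrite leq_addl.
apply: (@le_trans _ _ (P (\bigcup_n Fn n))).
  by apply: le_measure; rewrite ?inE.
have ndF : nondecreasing_seq Fn.
  move=> n m nm; apply/subsetPset => w Fw k /= mk; apply: Fw => /=.
  by apply: leq_trans mk; rewrite leq_add2l.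
have cvF := nondecreasing_cvg_mu mFn mF ndF (mu := P).
rewrite -(cvg_lim _ cvF) //; apply: lime_le; first by apply/cvg_ex; eexists; exact: cvF.
apply: nearW => n /=; apply: (@le_trans _ _ (P (Ek (k0 + n)))).
  apply: le_measure; rewrite ?inE //; [exact: mFn|exact: mEk|].
  by move=> w; apply => /=.
by apply: k0P; rewrite leq_addr.
Unshelve. all: by end_near.
Qed.

End FeynmanKac.

(** * The replacement error as a quadratic form *)

Section LocalBundle.
Variables (R : realType) (Gam : groupType) (S : {fset Gam}) (o : Gam).
Hypotheses (S_symmetric : symmetric_set S) (S_generates : generated_by S).
Variable f : Gam -> config Gam -> R.

Lemma vertex_bundle_shift x y (eta : config Gam) : vertex_bundle S f ->
  f (x * y)%g eta = f y (fun z => eta (x * z)%g).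
Proof.
case=> _ inv; rewrite -(inv x y); congr (f _ _).
by apply/funext => z; rewrite /cact mulVKg.
Qed.

Lemma vertex_bundle_local : vertex_bundle S f ->
  exists2 B : seq Gam, uniq B & forall eta xi : config Gam,
  {in B, eta =1 xi} -> f o eta = f o xi.
Proof.
case=> -[r r0 loc] _; have [B uB BP] := cball_finite S_symmetric S_generates o r.
by exists B => // eta xi E; apply: loc => z /BP; exact: E.
Qed.

Variable B : seq Gam.
Hypotheses (B_uniq : uniq B).
Hypothesis f_local : forall eta xi : config Gam,
  {in B, eta =1 xi} -> f o eta = f o xi.

(** [f o] as a function of the values on [B]; locality makes the value off [B]
    immaterial. *)
Definition pattern (s : seq bool) : R := f o (fun z => nth false s (index z B)).

Lemma patternE eta : f o eta = pattern (map eta B).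
Proof.
apply: f_local => z zB.
by rewrite (nth_map 1%g) ?index_mem // nth_index.
Qed.

Lemma pattern_bounded : exists2 C, 0 <= C & forall s, `|pattern s| <= C.
Proof.
exists (\sum_(t : (size B).-tuple bool) `|pattern t|); first exact: sumr_ge0.
move=> s; pose t := [tuple of map (fun z => nth false s (index z B)) (in_tuple B)].
have -> : pattern s = pattern t by rewrite /pattern patternE /=.
by rewrite (bigD1 t) //= lerDl sumr_ge0.
Qed.

Variables (C : R) (A : {fset Gam}).
Hypotheses (C0 : 0 <= C) (pattern_le : forall s, `|pattern s| <= C).
Hypothesis A0 : A != fset0.

Definition window : seq Gam := undup [seq (s * z)%g | s <- A, z <- B].

(** The local average over [A] as a function of the values on the window. *)
Definition window_avg (bs : seq bool) : R :=
  #|` A|%:R^-1 *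
  \sum_(s <- A) pattern [seq nth false bs (index y window) | y <- map (fun z => s * z)%g B].

Lemma window_sub s : s \in A -> {subset map (fun z => s * z)%g B <= window}.
Proof.
move=> sA _ /mapP[z zB ->]; rewrite mem_undup.
by apply/allpairsP; exists (s, z).
Qed.

Lemma size_window : (size window <= #|` A| * size B)%N.
Proof.
by apply: leq_trans (size_undup _) _; rewrite size_allpairs.
Qed.

Lemma cardA_gt0 : 0 < #|` A|%:R :> R.
Proof. by rewrite ltr0n cardfs_gt0. Qed.

Lemma window_avg_norm s : `|window_avg s| <= C.
Proof.
rewrite /window_avg normrM ger0_norm ?invr_ge0 // ler_pdivrMl ?cardA_gt0 //.
apply: le_trans (ler_norm_sum _ _ _) _.
by apply: le_trans (ler_sum _ (fun i _ => pattern_le _)) _; rewrite sum_const_seq.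
Qed.

(** A site of the window is read by at most [size B] of the translates. *)
Lemma window_avg_influence s1 b b' s2 :
  `|window_avg (s1 ++ b :: s2) - window_avg (s1 ++ b' :: s2)| <=
  2 * C * (size B)%:R / #|` A|%:R.
Proof.
rewrite /window_avg -mulrBr -sumrB normrM ger0_norm ?invr_ge0 //.
rewrite mulrC ler_pM2r ?invr_gt0 ?cardA_gt0 //.
apply: le_trans (ler_norm_sum _ _ _) _.
pose v := nth 1%g window (size s1).
apply: (@le_trans _ _ (\sum_(s <- A) \sum_(z <- B) (s == v * z^-1)%g%:R * (2 * C))).
  rewrite !big_seq; apply: ler_sum => s sA.
  set D := leLHS; have D2 : D <= 2 * C.
    apply: le_trans (ler_normB _ _) _.
    by have := lerD (pattern_le [seq nth false (s1 ++ b :: s2) (index y window) | y <- map (fun z => s * z)%g B])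
      (pattern_le [seq nth false (s1 ++ b' :: s2) (index y window) | y <- map (fun z => s * z)%g B]); lra.
  have [/hasP[z zB /eqP sz]|/hasPn nosz] := boolP (has (fun z => s == v * z^-1)%g B).
    rewrite (big_rem z) //= {1}sz eqxx mul1r; apply: ler_wpDr => //.
    by apply: sumr_ge0 => y _; rewrite mulr_ge0 ?mulr_ge0.
  suff -> : D = 0.
    by apply: sumr_ge0 => y _; rewrite mulr_ge0 ?mulr_ge0.
  apply/eqP; rewrite normr_eq0 subr_eq0; apply/eqP; congr pattern.
  apply/eq_in_map => y ymap; rewrite !nth_cat.
  have yw := window_sub sA ymap.
  have neq : index y window != size s1.
    apply/eqP => iy; have : nth 1%g window (index y window) = y by rewrite nth_index.
    rewrite iy -/v => vy; case/mapP: ymap => z zB ey.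
    by have := nosz z zB; rewrite vy ey mulgK eqxx.
  case: ltnP => // le; have : (0 < index y window - size s1)%N.
    by rewrite subn_gt0 ltn_neqAle eq_sym neq.
  by case: (_ - _)%N.
rewrite exchange_big /=.
under eq_bigr do rewrite -mulr_suml sum_count_mem.
rewrite -mulr_suml mulrC ler_wpM2l ?mulr_ge0 //.
apply: (@le_trans _ _ (\sum_(z <- B) 1)); last by rewrite sum_const_seq mulr1.
by apply: ler_sum => z _; rewrite count_uniq_mem ?fset_uniq // lern1; case: (_ \in _).
Qed.

Lemma window_avgE N (q : quot N) (eta : qconfig N) : vertex_bundle S f ->
  local_avg o A f (lift_quot q * o)%g (Defs.periodic eta) =
  window_avg (map eta (map (fun v => Defs.proj N (lift_quot q * v)%g) window)).
Proof.
move=> fb; rewrite /local_avg /window_avg; congr (_ * _).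
rewrite !big_seq; apply: eq_bigr => s sA.
rewrite mulgK (vertex_bundle_shift _ _ _ fb) patternE -map_comp; congr pattern.
apply/eq_in_map => z zB /=.
have szw : (s * z)%g \in window by apply: (window_sub sA); apply/mapP; exists z.
rewrite -map_comp (nth_map 1%g) ?index_mem // nth_index //= /Defs.periodic mulgA.
by [].
Qed.

Variables (rho : R) (nu : probability (configSpace Gam) R).
Hypotheses (rho01 : 0 <= rho <= 1) (nu_bernoulli : bernoulli_product rho nu).

Lemma local_mean : fine 'E_nu[f o] = bern_exp rho (size B) pattern.
Proof.
rewrite -[RHS]/(fine (bern_exp rho (size B) pattern)%:E) -(expectation_local nu_bernoulli) //.
by congr (fine 'E_nu[_]); apply/funext => eta; exact: patternE.
Qed.

(** All translates have the same mean, since the product measure does not see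
    which distinct sites are read. *)
Lemma window_avg_mean :
  bern_exp rho (size window) window_avg = bern_exp rho (size B) pattern.
Proof.
rewrite /window_avg bern_expZ bern_exp_sum.
rewrite (eq_big_seq (fun=> bern_exp rho (size B) pattern)).
  by rewrite sum_const_seq mulrA mulVf ?mul1r // gt_eqF ?cardA_gt0.
move=> s sA /=; rewrite (bern_exp_subset nu_bernoulli) ?size_map ?undup_uniq //.
- by rewrite map_inj_uniq // => x y /mulgI.
- exact: window_sub.
Qed.

(** The law of large numbers, uniformly in the density [rho]: at most
    [#|` A| * size B] sites have an influence of order [1 / #|` A|] each. *)
Lemma window_avg_deviation beta : 0 < beta ->
  bern_exp rho (size window)
    (fun s => `|window_avg s - bern_exp rho (size B) pattern|) <=
  beta + 4 * C ^+ 2 * (size B)%:R ^+ 3 / beta / #|` A|%:R.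
Proof.
move=> b0; rewrite -window_avg_mean.
apply: le_trans (bern_exp_deviation _ rho01 b0 window_avg_influence) _.
rewrite lerD2l -mulrA.
have a0 := cardA_gt0.
have : (size window)%:R <= #|` A|%:R * (size B)%:R :> R by rewrite -natrM ler_nat size_window.
have : 0 <= (2 * C * (size B)%:R / #|` A|%:R) ^+ 2 / beta.
  by rewrite divr_ge0 ?sqr_ge0 // ltW.
move=> h /(ler_wpM2r h) /le_trans; apply.
rewrite le_eqVlt; apply/orP; left; apply/eqP.
move: a0; move: (#|` A|%:R) => n n0; field.
by rewrite !gt_eqF.
Qed.

End LocalBundle.

Section ErrorForm.
Variables (R : realType) (Gam : groupType) (S : {fset Gam}) (o : Gam).
Hypotheses (S_symmetric : symmetric_set S) (S_generates : generated_by S).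
Variables (f : Gam -> config Gam -> R) (B : seq Gam) (C : R).
Hypotheses (f_bundle : vertex_bundle S f) (B_uniq : uniq B).
Hypothesis f_local : forall eta xi : config Gam,
  {in B, eta =1 xi} -> f o eta = f o xi.
Hypotheses (C0 : 0 <= C) (pattern_le : forall s, `|pattern o f B s| <= C).
Variable nu : R -> probability (configSpace Gam) R.
Hypothesis nu_bernoulli : forall rho : R, 0 <= rho <= 1 ->
  bernoulli_product rho (nu rho).
Variables (N : finite_index_normal Gam) (A D : {fset Gam}) (theta ell : R).
Hypotheses (A0 : A != fset0) (D0 : D != fset0).
Local Notation W := (window B A).
Local Notation at_ q z := (Defs.proj N (lift_quot q * z)%g).
Local Notation X := {ffun quot N -> bool}.
Hypothesis W_inj : {in W &, forall x y, Defs.proj N x = Defs.proj N y -> x = y}.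
Hypothesis D_fraction : forall E : seq Gam, uniq E -> {subset E <= D} ->
  {in E &, forall x y, Defs.proj N x = Defs.proj N y} ->
  (size E)%:R <= theta * #|` D|%:R.
Hypothesis W_paths : forall z y, z \in W -> y \in D ->
  exists2 n, walk (cayley_adj S) n z (y * o)%g & n%:R <= ell.

Let sites (q : quot N) : seq (quot N) := [seq at_ q (y * o)%g | y <- D].
Let spread (s : seq bool) (p : R) : R :=
  `|window_avg o f B A s - bern_exp p (size B) (pattern o f B)|.

Lemma occupation_avgE (q : quot N) (eta : qconfig N) :
  local_avg o D (@occupation Gam R) (lift_quot q * o)%g (Defs.periodic eta) =
  density R (sites q) eta.
Proof.
rewrite /local_avg /density size_map big_map; congr (_ * _).
apply: eq_bigr => y _; rewrite /occupation /Defs.periodic mulgK.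
by rewrite mulgA.
Qed.

Lemma sites_fraction q w : (count_mem w (sites q))%:R <= theta * (size (sites q))%:R.
Proof.
rewrite size_map count_map -size_filter; apply: D_fraction.
- by apply: filter_uniq; exact: fset_uniq.
- by move=> y; rewrite mem_filter => /andP[].
move=> x y; rewrite !mem_filter /= => /andP[/eqP ex _] /andP[/eqP ey _].
by rewrite -ey in ex; move/proj_mulgl/proj_mulgr: ex.
Qed.

(** For each [q], the sites of the window around [q] are replaced by samples
    from the large block around [q]; what remains is a Bernoulli expectation at
    the density of that block, small by the law of large numbers.  Summing over
    [q] turns the exchange energies into path energies. *)
Lemma spread_mean_error (g : X -> R) (beta1 beta2 : R) : 0 < beta1 -> 0 < beta2 ->
  \sum_(eta : X) (\sum_(q : quot N)
     `|local_avg o A f (lift_quot q * o)%g (Defs.periodic eta) -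
       bernoulli_mean nu f o
         (local_avg o D (@occupation Gam R) (lift_quot q * o)%g (Defs.periodic eta))|) *
     g eta ^+ 2 <=
  #|quot N|%:R * ((beta1 + 4 * C ^+ 2 * (size B)%:R ^+ 3 / beta1 / #|` A|%:R +
    (size W)%:R * (2 * theta * (2 * C * (size B)%:R) +
       2 * (2 * C) * (size W)%:R * theta + 2 * C * beta2)) * sqnorm g) +
  2 * C / beta2 * ((size W)%:R * (4 * ell ^+ 2 * total_energy S g)).
Proof.
move=> b10 b20.
have D1 : 0 < #|` D|%:R :> R by rewrite ltr0n cardfs_gt0.
have rho01 q eta : 0 <= density R (sites q) eta <= 1 by exact: density_bounds.
set dev := beta1 + _.
set repl := _ + 2 * C * beta2.
have bern_le p : 0 <= p <= 1 -> `|bern_exp p (size B) (pattern o f B)| <= C.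
  by move=> p01; apply: bern_exp_norm.
have spread_le s p : 0 <= p <= 1 -> `|spread s p| <= 2 * C.
  move=> p01; rewrite normr_id; apply: le_trans (ler_normB _ _) _.
  by have := window_avg_norm pattern_le A0 s; have := bern_le p p01; lra.
have spread_lip s p p' : 0 <= p <= 1 -> 0 <= p' <= 1 ->
    `|spread s p - spread s p'| <= 2 * C * (size B)%:R * `|p - p'|.
  move=> p01 p01'; apply: le_trans (ler_dist_dist _ _) _.
  have -> : forall x y z : R, x - y - (x - z) = z - y by move=> x y z; ring.
  by rewrite (distrC p); apply: bern_exp_lipschitz.
have one (q : quot N) : \sum_(eta : X)
    `|local_avg o A f (lift_quot q * o)%g (Defs.periodic eta) -
       bernoulli_mean nu f o
         (local_avg o D (@occupation Gam R) (lift_quot q * o)%g (Defs.periodic eta))| *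
     g eta ^+ 2 <=
   (dev + (size W)%:R * repl) * sqnorm g +
   2 * C / beta2 * (#|` D|%:R^-1 * \sum_(z <- W) \sum_(y <- D)
     exchange_energy g (at_ q z) (at_ q (y * o)%g)).
  pose rest := map (fun v => at_ q v) W.
  have urest : uniq rest.
    rewrite map_inj_in_uniq ?undup_uniq // => x y xW yW /proj_mulgl.
    exact: W_inj.
  have C20 : 0 <= 2 * C by rewrite mulr_ge0.
  have Lp0 : 0 <= 2 * C * (size B)%:R by rewrite mulr_ge0.
  have ssites : (0 < size (sites q))%N by rewrite size_map cardfs_gt0.
  have disj : ~~ has (mem ([::] : seq (quot N))) rest by apply/hasPn.
  have szr : (size ([::] : seq (quot N)) + size rest <= size W)%N by rewrite size_map.
  have := replacement g C20 Lp0 b20 ssites (sites_fraction q) spread_le spread_lip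
    urest disj szr.
  rewrite cat0s -/repl; set lhs := leLHS; set bern := \sum_(eta : X) bern_exp _ _ _ * _.
  have -> : \sum_(eta : X)
      `|local_avg o A f (lift_quot q * o)%g (Defs.periodic eta) -
       bernoulli_mean nu f o
         (local_avg o D (@occupation Gam R) (lift_quot q * o)%g (Defs.periodic eta))| *
       g eta ^+ 2 = lhs.
    apply: eq_bigr => eta _; congr (_ * _).
    rewrite (window_avgE f_local A q eta f_bundle) occupation_avgE /bernoulli_mean.
    by rewrite (local_mean B_uniq f_local (nu_bernoulli (rho01 q eta))).
  have bern_dev : bern <= dev * sqnorm g.
    rewrite /sqnorm mulr_sumr; apply: ler_sum => eta _; rewrite ler_wpM2r ?sqr_ge0 //.
    rewrite size_map.
    exact: (window_avg_deviation B_uniq C0 pattern_le A0 (rho01 q eta) (nu_bernoulli (rho01 q eta)) b10).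
  move=> /le_trans; apply.
  rewrite [in leRHS]mulrDl -(mulrA (size W)%:R) size_map; apply: lerD; first by rewrite lerD2r.
  rewrite le_eqVlt; apply/orP; left; apply/eqP; congr (_ * _).
  rewrite big_map mulr_sumr; apply: eq_bigr => z _.
  by rewrite size_map big_map.
under eq_bigr do rewrite mulr_suml.
rewrite exchange_big /=.
apply: le_trans (ler_sum _ (fun q _ => one q)) _.
rewrite big_split /= sumr_const -[_ *+ _]mulr_natl lerD2l -mulr_sumr.
rewrite ler_wpM2l ?divr_ge0 ?mulr_ge0 // ?(ltW b20) //.
rewrite -mulr_sumr ler_pdivrMl // exchange_big /=.
have E0 := total_energy_ge0 S g.
apply: (@le_trans _ _ (\sum_(z <- W) \sum_(y <- D) 4 * ell ^+ 2 * total_energy S g)).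
  rewrite !big_seq; apply: ler_sum => z zW; rewrite exchange_big /= !big_seq.
  apply: ler_sum => y yD; have [n w nl] := W_paths zW yD.
  apply: le_trans (path_energy g w) _; rewrite ler_wpM2r // ler_pM2l //.
  by rewrite ler_sqr ?nnegrE // (le_trans _ nl).
rewrite !sum_const_seq.
by rewrite le_eqVlt; apply/orP; left; apply/eqP; ring.
Qed.

End ErrorForm.

(** * Choosing the constants *)

Lemma limf_esup_le (R : realType) (T : choiceType) (Y : filteredType T) (F : set_system Y)
    (u : Y -> \bar R) (l : \bar R) :
  (\forall x \near F, (u x <= l)%E) -> (limf_esup u F <= l)%E.
Proof.
move=> Fu; apply: (@le_trans _ _ (ereal_sup (u @` [set x | (u x <= l)%E]))).
  by apply: ereal_inf_lbound; exists [set x | (u x <= l)%E].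
by apply: ge_ereal_sup => _ [x /= ux <-].
Qed.

Lemma iterated_limsup (R : realType) (u : nat -> R -> nat -> \bar R) :
  (forall A : R, exists i0 : nat, forall i, (i0 <= i)%N ->
     exists2 eps0 : R, 0 < eps0 & forall eps, 0 < eps < eps0 ->
     exists m0 : nat, forall m, (m0 <= m)%N -> (u i eps m <= A%:E)%E) ->
  (fun i => limf_esup (fun eps => limn_esup (u i eps)) (0 : R)^'+) @ \oo --> -oo%E.
Proof.
move=> H; apply/cvgeNyPle => A; have [i0 i0P] := H A.
exists i0 => // i /= ii0; have [eps0 eps00 epsP] := i0P i ii0.
apply: limf_esup_le; near=> eps; apply: limf_esup_le.
have eps0P : 0 < eps < eps0.
  apply/andP; split; near: eps; [exact: nbhs_right_gt|exact: nbhs_right_lt].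
by have [m0 m0P] := epsP eps eps0P; exists m0.
Unshelve. all: by end_near.
Qed.

Section QuadraticForm.
Variables (R : realType) (Gam : groupType) (S : {fset Gam}).
Hypotheses (Gam_infinite : infinite_set [set: Gam]).
Hypotheses (S_symmetric : symmetric_set S) (S_generates : generated_by S).
Variable G : nat -> finite_index_normal Gam.
Hypothesis G_descending : forall i, G i.+1 `<=` G i.
Hypothesis G_separates :
  \bigcap_(i in [set i | (1 <= i)%N]) (G i : set Gam) = [set 1%g].
Variable F : nat -> {fset Gam}.
Hypothesis F_folner : folner R S F.
Variable o : Gam.
Variable nu : R -> probability (configSpace Gam) R.
Hypothesis nu_bernoulli : forall rho : R, 0 <= rho <= 1 ->
  bernoulli_product rho (nu rho).
Variable c : Gam * Gam -> config Gam -> R.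
Hypothesis c_rate : jump_rate S c.
Variable t : nat -> R.
Hypothesis t_infty : t @ \oo --> +oo.
Variable f : Gam -> config Gam -> R.
Hypothesis f_bundle : vertex_bundle S f.

Lemma window_walks (W : seq Gam) : exists L : nat, forall z y, z \in W ->
  exists2 n, walk (cayley_adj S) n z (y * o)%g &
             (n <= L + gdist (cayley_adj S) o y)%N.
Proof.
have [n1 w1] := walk_connected S_symmetric S_generates 1%g o.
have [L LP] : exists L : nat, forall z, z \in W -> exists2 n,
    walk (cayley_adj S) n z o & (n <= L)%N.
  elim: W => [|x W [L LP]]; first by exists 0%N.
  have [n w] := walk_connected S_symmetric S_generates x o.
  exists (maxn n L) => z; rewrite inE => /orP[/eqP ->|/LP[k wk kL]].
    by exists n; rewrite ?leq_maxl.
  by exists k => //; rewrite leq_max kL orbT.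
exists (L + n1)%N => z y /LP[n w nL].
exists (n + (gdist (cayley_adj S) o y + n1))%N.
  apply: walk_cat w _; apply: walk_cat (gdist_walk S_symmetric S_generates o y) _.
  by have := walk_mulg y w1; rewrite mulg1.
by rewrite addnA addnAC !leq_add2r.
Qed.

(** All constants are chosen here, in the order in which the limits are taken:
    [i] makes the law of large numbers error small, then [beta2] and [theta]
    depend on the window of [F i], [eps] makes the exchanges over distance
    [eps * sqrt t] cheaper than [t] times the Dirichlet form, and [m] makes the
    window embed into the quotient and the collisions rare. *)
Lemma quadratic_form_bound (a : R) : 0 < a -> exists i0 : nat,
  forall i, (i0 <= i)%N -> exists2 eps0 : R, 0 < eps0 &
  forall eps, 0 < eps < eps0 -> exists m0 : nat, forall m, (m0 <= m)%N ->
  [/\ (1 <= m)%N, 0 <= t m & forall g : {ffun quot (G m) -> bool} -> R,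
  \sum_(eta : {ffun quot (G m) -> bool}) g eta *
     (t m * exclusion_gen S c g eta +
      a * replacement_error S F nu f o (eps * Num.sqrt (t m)) i eta * g eta) <=
  #|quot (G m)|%:R * \sum_(eta : {ffun quot (G m) -> bool}) g eta ^+ 2].
Proof.
move=> a0; have [Fne _] := F_folner.
have [B B_uniq f_local] := vertex_bundle_local o S_symmetric S_generates f_bundle.
have [C C0 pattern_le] := pattern_bounded f_local.
have [_ _ _ [c0 c00 c_low]] := c_rate.
have [lc lcP] := rate_exchange S_symmetric S_generates c_rate.
pose beta1 : R := 8^-1 / a.
have b10 : 0 < beta1 by rewrite divr_gt0.
have ab1 : a * beta1 = 8^-1 by rewrite /beta1 mulrC divfK // gt_eqF.
pose K1 := 8 * (a * (4 * C ^+ 2 * (size B)%:R ^+ 3 / beta1)).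
have K10 : 0 <= K1.
  by rewrite !mulr_ge0 ?sqr_ge0 ?exprn_ge0 ?invr_ge0 // ltW.
have K1V : 0 < (K1 + 1)^-1 by rewrite invr_gt0 ltr_wpDl.
have [i0 i01 i0P] := folner_card Gam_infinite S_generates F_folner G_descending G_separates K1V.
exists i0 => i ii0; have Fi0 : F i != fset0 by apply: Fne; apply: leq_trans ii0.
have Fi1 : 0 < #|` F i|%:R :> R by rewrite ltr0n cardfs_gt0.
have lln : a * (4 * C ^+ 2 * (size B)%:R ^+ 3 / beta1 / #|` F i|%:R) <= 8^-1.
  have := i0P i ii0; rewrite ler_pdivlMl ?ltr_wpDl // mulr1 => h.
  rewrite mulrA ler_pdivrMr //; move: h; rewrite /K1; lra.
pose W := window B (F i); pose k : R := (size W)%:R.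
have k0 : 0 <= k by [].
pose beta2 : R := 8^-1 / (a * (k * (2 * C)) + 1).
have d1 : 0 < a * (k * (2 * C)) + 1.
  by rewrite ltr_wpDl // !mulr_ge0 // ltW.
have b20 : 0 < beta2 by rewrite divr_gt0.
have ab2 : a * (k * (2 * C * beta2)) <= 8^-1.
  have : beta2 * (a * (k * (2 * C)) + 1) = 8^-1 by rewrite /beta2 divfK // gt_eqF.
  move=> E; have : 0 < beta2 by []; move: E; lra.
pose Th := k * (2 * (2 * C * (size B)%:R) + 2 * (2 * C) * k).
have Th0 : 0 <= Th.
  by apply: mulr_ge0 => //; apply: addr_ge0; rewrite !mulr_ge0.
pose theta : R := 8^-1 / (a * Th + 1).
have d2 : 0 < a * Th + 1 by rewrite ltr_wpDl // mulr_ge0 // ltW.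
have th0 : 0 < theta by rewrite divr_gt0.
have ath : a * (Th * theta) <= 8^-1.
  have : theta * (a * Th + 1) = 8^-1 by rewrite /theta divfK // gt_eqF.
  move=> E; have : 0 < theta by []; move: E; lra.
pose Q := a * (2 * C / beta2 * (k * 16)).
have Q0 : 0 <= Q.
  apply: mulr_ge0; first exact: ltW.
  by apply: mulr_ge0; rewrite ?mulr_ge0 ?invr_ge0 ?(ltW b20).
have d3 : 0 < 2 * (Q + 1) by rewrite mulr_gt0 // ltr_wpDl.
exists (Num.min 1 (c0 / (2 * (Q + 1)))).
  by rewrite lt_min ltr01 divr_gt0.
move=> eps /andP[eps0]; rewrite lt_min => /andP[eps1 epsc].
have Qeps : Q * eps ^+ 2 <= c0 / 2.
  have e2 : eps ^+ 2 <= eps by rewrite expr2 ler_piMl // ltW.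
  rewrite ltr_pdivlMr // in epsc.
  have := ler_wpM2l Q0 e2; have : Q * eps <= c0 / 2 by move: epsc; lra.
  lra.
have [b1 [m1 fracP]] := coset_fraction Gam_infinite S_generates F_folner
  G_descending G_separates th0.
have [m2 m2P] := avoid_subgroups G_descending G_separates
  ([seq (x^-1 * y)%g | x <- W, y <- W] ++ lc).
have [K0 K0P] := largest_insideP Gam_infinite S_symmetric S_generates F_folner
  G_descending G_separates o (maxn 1 b1).
have [L LP] := window_walks W.
(* Beyond [K2] the radius exceeds the distances that do not grow with [m], so
   that the paths used below have length at most [2 * K]. *)
pose K2 : R := Num.max (Num.max K0 L%:R) 0.
have [m3 _ m3P] : \forall m \near \oo, (K2 / eps) ^+ 2 <= t m.
  by have /cvgryPge := t_infty; apply.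
exists (maxn 1 (maxn m1 (maxn m2 m3))) => m.
rewrite !geq_max => /and4P[m11 mm1 mm2 mm3].
have tm := m3P m mm3; rewrite /= in tm.
have tm0 : 0 <= t m by apply: le_trans tm; exact: sqr_ge0.
split=> // g.
set K := eps * Num.sqrt (t m).
have K20 : 0 <= K2 by rewrite /K2 le_max lexx orbT.
have KK2 : K2 <= K.
  rewrite /K mulrC -ler_pdivrMr //; have q0 : 0 <= K2 / eps by rewrite divr_ge0 // ltW.
  by rewrite -[leLHS]ger0_norm // -sqrtr_sqr ler_wsqrtr.
have [KK0 KL] : K0 <= K /\ L%:R <= K.
  by move: KK2; rewrite !ge_max => /andP[/andP[]].
have [bb1 insideP] := K0P K KK0.
set b := largest_inside S o F K in bb1 insideP.
rewrite geq_max in bb1; case/andP: bb1 => b11 bb1.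
have Fb0 : F b != fset0 by exact: Fne.
have W_inj : {in W &, forall x y, Defs.proj (G m) x = Defs.proj (G m) y -> x = y}.
  move=> x y xW yW /proj_eqP Gxy; have xy1 : (x^-1 * y = 1)%g.
    apply: (m2P m mm2) => //; rewrite mem_cat; apply/orP; left.
    by apply/allpairsP; exists (x, y).
  by rewrite -(mulVKg x y) xy1 mulg1.
have W_paths z y : z \in W -> y \in F b ->
    exists2 n, walk (cayley_adj S) n z (y * o)%g & n%:R <= 2 * K.
  move=> zW yF; have [n w nL] := LP z y zW; exists n => //.
  have yK : (gdist (cayley_adj S) o y)%:R <= K.
    by apply: (insideP b) => //; rewrite b11 leqnn.
  move: nL; rewrite -(ler_nat R) natrD; lra.
have lc1 x : x \in lc -> (G m : set Gam) x -> x = 1%g.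
  by move=> xl; apply: (m2P m mm2); rewrite mem_cat xl orbT.
have V_le := spread_mean_error f_bundle B_uniq f_local C0 pattern_le
  nu_bernoulli Fi0 Fb0 W_inj (fracP b m bb1 mm1) W_paths g b10 b20.
have D_le := dirichlet_form g (lcP _ lc1)
  (fun e eta => c_low _ _ (lift_edge_edges e)).
have E0 := total_energy_ge0 S g.
have g0 := sqnorm_ge0 g.
set n : R := #|quot (G m)|%:R.
rewrite -/W -/k -/n in V_le.
set V := (X in X <= _) in V_le.
have -> : \sum_(eta : {ffun quot (G m) -> bool}) g eta *
     (t m * exclusion_gen S c g eta +
      a * replacement_error S F nu f o K i eta * g eta) =
  t m * (\sum_(eta : {ffun quot (G m) -> bool}) g eta * exclusion_gen S c g eta) + a * V.
  rewrite !mulr_sumr -big_split; apply: eq_bigr => eta _ /=.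
  by rewrite /replacement_error -/b; ring.
have {}D_le := ler_wpM2l tm0 D_le.
have {}V_le := ler_wpM2l (ltW a0) V_le.
have ell : (2 * K) ^+ 2 = 4 * (eps ^+ 2 * t m).
  by rewrite /K !exprMn sqr_sqrtr //; ring.
rewrite ell in V_le.
set E := total_energy S g in E0 D_le V_le.
have n0 : 0 <= n by [].
have ng0 : 0 <= n * sqnorm g by rewrite mulr_ge0.
have h1 := ler_wpM2r ng0 lln.
have h2 := ler_wpM2r ng0 ab2.
have h3 := ler_wpM2r ng0 ath.
have tE0 : 0 <= t m * E by rewrite mulr_ge0.
have h4 := ler_wpM2r tE0 Qeps.
rewrite -/(sqnorm g).
apply: le_trans (lerD D_le V_le) _.
have -> : a * (n * ((beta1 + 4 * C ^+ 2 * (size B)%:R ^+ 3 / beta1 / #|` F i|%:R +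
    k * (2 * theta * (2 * C * (size B)%:R) + 2 * (2 * C) * k * theta + 2 * C * beta2)) *
    sqnorm g) + 2 * C / beta2 * (k * (4 * (4 * (eps ^+ 2 * t m)) * E))) =
  a * beta1 * (n * sqnorm g) +
  a * (4 * C ^+ 2 * (size B)%:R ^+ 3 / beta1 / #|` F i|%:R) * (n * sqnorm g) +
  a * (Th * theta) * (n * sqnorm g) + a * (k * (2 * C * beta2)) * (n * sqnorm g) +
  Q * eps ^+ 2 * (t m * E).
  by rewrite /Q /Th; move: beta1^-1 beta2^-1 (#|` F i|%:R^-1) => x1 x2 x3; ring.
rewrite ab1; lra.
Qed.

End QuadraticForm.

(** * The super-exponential estimate *)

Theorem theorem2p1 (R : realType) (Gam : groupType) (S : {fset Gam})
  (Gam_infinite : infinite_set [set: Gam])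
  (S_symmetric : symmetric_set S)
  (S_generates : generated_by S)
  (G : nat -> finite_index_normal Gam)
  (G_descending : forall i, G i.+1 `<=` G i)
  (G_separates : \bigcap_(i in [set i | (1 <= i)%N]) (G i : set Gam) = [set 1%g])
  (F : nat -> {fset Gam})
  (F_folner : folner R S F)
  (o : Gam)
  (nu : R -> probability (configSpace Gam) R)
  (nu_bernoulli : forall rho : R, 0 <= rho <= 1 -> bernoulli_product rho (nu rho))
  (c : Gam * Gam -> config Gam -> R)
  (c_rate : jump_rate S c)
  (t : nat -> R)
  (t_pos : 0 < t 1%N)
  (t_incr : forall m, (1 <= m)%N -> t m < t m.+1)
  (t_infty : t @ \oo --> +oo)
  (t_diam : forall m, (1 <= m)%N ->
    Num.sqrt (t m) <= 2 * (quot_diam S (G m))%:R)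
  (T : R) (T_pos : 0 < T)
  (f : Gam -> config Gam -> R)
  (f_bundle : vertex_bundle S f)
  (mu : forall m, probability (qconfigSpace (G m)) R)
  (P : forall m, probability (pathSpace T (qconfig (G m))) R)
  (P_law : forall m, (1 <= m)%N ->
    markov_law (fun H eta => t m * exclusion_gen S c H eta) (mu m) (P m))
  (delta : R) (delta_pos : 0 < delta) :
  (fun i : nat =>
     limf_esup (fun eps : R =>
       limn_esup (fun m : nat =>
         (#|quot (G m)|%:R^-1%:E *
          lne (P m [set w : cadlag T (qconfig (G m)) |
                     (delta <= #|quot (G m)|%:R^-1 *
                        \int[lebesgue_measure]_(s in `[0%R, T])
                          replacement_error S F nu f o
                            (eps * Num.sqrt (t m)) i (w s))%R]))%E))
       (0 : R)^'+) @ \oo --> -oo%E.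
Proof.
apply: iterated_limsup => A.
(* With [n] the number of vertices, the exponent obtained below is at most
   [n * (2 + T - a * delta / 2)]: one unit for the [2 ^ n] configurations, one
   for the rounding in [feynman_kac], and [T] for the quadratic form bound. *)
pose a : R := 2 * (2 + T + `|A|) / delta.
have a0 : 0 < a.
  by rewrite divr_gt0 // mulr_gt0 // ltr_wpDr // addr_gt0.
have [i0 H] := quadratic_form_bound Gam_infinite S_symmetric S_generates
  G_descending G_separates F_folner o nu_bernoulli c_rate t_infty f_bundle a0.
exists i0 => i /H[eps0 eps00 {}H]; exists eps0 => // eps /H[m0 {}H].
exists m0 => m /H[m1 tm0 {}H].
pose V := quot (G m); pose n : R := #|V|%:R.
have n1 : 1 <= n.
  rewrite ler1n; apply/card_gt0P; exists (Defs.proj (G m) 1%g); by [].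
have n0 : 0 < n by apply: lt_le_trans n1.
pose U := replacement_error S F nu f o (eps * Num.sqrt (t m)) i (N := G m).
have [M M0 LM] := exclusion_gen_bounded S (G m) c.
pose L (h : {ffun V -> bool} -> R) (eta : {ffun V -> bool}) : R :=
  t m * exclusion_gen S c h eta.
have tM0 : 0 <= t m * M by rewrite mulr_ge0.
have L_bounded (h : {ffun V -> bool} -> R) B : (forall x, `|h x| <= B) ->
    forall x, `|L h x| <= t m * M * B.
  by move=> hB x; rewrite normrM ger0_norm // -mulrA ler_wpM2l // LM.
have L_linear (h : {ffun V -> bool} -> R) x :
    L h x = \sum_(y : {ffun V -> bool}) h y * L (fun z => (z == y)%:R) x.
  rewrite /L exclusion_gen_linear mulr_sumr; apply: eq_bigr => y _; ring.
pose Um := \sum_(eta : {ffun V -> bool}) `|U eta|.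
have Um0 : 0 <= Um by exact: sumr_ge0.
have UmP (eta : {ffun V -> bool}) : `|U eta| <= Um.
  by rewrite /Um (bigD1 eta) //= lerDl sumr_ge0.
have nd0 : 0 < n * delta by rewrite mulr_gt0.
have := feynman_kac T_pos (P_law m m1) (ltW a0) tM0 L_bounded L_linear Um0 UmP H nd0.
set E := [set w | _]; set E' := [set w | _].
have -> : E' = E.
  by apply/seteqP; split => w; rewrite /E /E' /= -/V -/n ler_pdivlMl.
rewrite -/V; have card : #|{: {ffun V -> bool}}|%:R <= expR n.
  rewrite card_ffun card_bool natrX /n -[_%:R in leRHS]mulr1 expRM_natl.
  by rewrite lerXn2r ?nnegrE ?expR_ge0 //; have := expR_ge1Dx (1 : R); lra.
have expo : #|{: {ffun V -> bool}}|%:R * expR (n * T + 1 - a * (n * delta / 2)) <=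
    expR (n * A).
  apply: le_trans (ler_wpM2r (expR_ge0 _) card) _; rewrite -expRD ler_expR.
  have -> : a * (n * delta / 2) = n * (2 + T + `|A|).
    by rewrite /a; field; rewrite gt_eqF.
  have : n * - `|A| <= n * A by rewrite ler_pM2l // lerNl -normrN ler_norm.
  lra.
move=> PE; have {}PE : (P m E <= (expR (n * A))%:E)%E.
  by apply: le_trans PE _; rewrite lee_fin.
rewrite lee_pdivrMl //; apply: (@le_trans _ _ (lne (expR (n * A))%:E)).
  by rewrite lee_lne ?in_itv /= ?andbT ?leey ?lee_fin ?expR_ge0 // measure_ge0.
by rewrite lne_EFin ?expR_gt0 // expRK -EFinM.
Qed.
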